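(* Let $\Omega\subset\mathbb R^3$ be an open connected set whose boundary is an embedded minimal surface $\mathcal M$, i.e. $H(y)=0$ for every $y\in\mathcal M$. Let $\kappa_0:=\inf_{y\in\mathcal M}|\kappa(y)|$ be the infimum of the absolute values of all the principal curvatures of $\mathcal M$. Then for every $f\in C_0^\infty(\Omega)$, $$\int_\Omega|\nabla f|^2\,dx\ \ge\ \frac14\int_\Omega\frac{|f|^2}{\delta^2}\,dx+\kappa_0^2\int_\Omega|f|^2\,dx .$$
   Context: The boundary of $\Omega$ is (nonempty and) $C^2$: near each boundary point $\Omega$ is, after a rotation, the region on one side of the graph of a $C^2$ function. $\delta(x)=\inf_{y\in\mathbb R^{3}\setminus\Omega}|x-y|$. $H=\kappa_1+\kappa_2$ is the sum of the two principal curvatures; since $H=0$, at each point the two principal curvatures have the same absolute value, denoted $|\kappa(y)|$. *)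

(* Defs.v *)
From HB Require Import structures.
From mathcomp Require Import all_boot all_order all_algebra.
From mathcomp Require Import all_classical all_reals all_analysis.
Set Implicit Arguments.
Unset Strict Implicit.
Unset Printing Implicit Defensive.
Import Order.TTheory GRing.Theory Num.Theory.
Import numFieldNormedType.Exports.
Local Open Scope classical_set_scope.
Local Open Scope ring_scope.

(* The norm and balls provided by the library on ['rV[R]_n] are those of the
   sup norm; they induce the usual topology and derivatives, but lengths and
   distances are always measured with [enorm] below. *)

Section Euclidean.
Context {R : realType}.

Definition enorm n (v : 'rV[R]_n) : R := Num.sqrt (\sum_i v 0 i ^+ 2).

Definition partial n (i : 'I_n.+1) (f : 'rV[R]_n.+1 -> R) : 'rV[R]_n.+1 -> R :=
  fun x => 'D_(delta_mx 0 i) f x.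

(* [partials [:: i1; ...; ik] f] is d_i1 (... (d_ik f)). *)
Definition partials n (s : seq 'I_n.+1) (f : 'rV[R]_n.+1 -> R) :
    'rV[R]_n.+1 -> R :=
  foldr (fun i g => partial i g) f s.

(* The partial derivatives of order at most k exist everywhere and are
   continuous; [derive] being total, existence is stated separately. *)
Definition of_class_C n (k : nat) (f : 'rV[R]_n.+1 -> R) : Prop :=
  (forall s : seq 'I_n.+1, (size s < k)%N ->
     forall i x, derivable (partials s f) x (delta_mx 0 i)) /\
  (forall s : seq 'I_n.+1, (size s <= k)%N -> continuous (partials s f)).

Definition smooth n (f : 'rV[R]_n.+1 -> R) : Prop :=
  forall k, of_class_C k f.

Definition gradient n (f : 'rV[R]_n.+1 -> R) (x : 'rV[R]_n.+1) :
    'rV[R]_n.+1 :=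
  \row_i partial i f x.

Definition hessian n (f : 'rV[R]_n.+1 -> R) (x : 'rV[R]_n.+1) : 'M[R]_n.+1 :=
  \matrix_(i, j) partials [:: i; j] f x.

(* C_0^oo(Omega), its elements being extended by 0 outside Omega. *)
Definition test_function n (Omega : set 'rV[R]_n.+1)
    (f : 'rV[R]_n.+1 -> R) : Prop :=
  [/\ smooth f, compact (closure [set x | f x != 0])
    & closure [set x | f x != 0] `<=` Omega].

Definition boundary n (Omega : set 'rV[R]_n.+1) : set 'rV[R]_n.+1 :=
  closure Omega `\` interior Omega.

Definition dist_compl n (Omega : set 'rV[R]_n.+1) (x : 'rV[R]_n.+1) : R :=
  inf [set enorm (x - y) | y in ~` Omega].

End Euclidean.

Section Surfaces.
Context {R : realType}.
Implicit Types (Omega : set 'rV[R]_3) (Q : 'M[R]_3) (phi : 'rV[R]_2 -> R).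

Definition rotation Q : Prop := Q *m Q^T = 1%:M /\ \det Q = 1.

(* In the rotated coordinates z = x *m Q, whose first two entries are
   [col' ord_max z] and whose last entry is [z 0 ord_max], Omega coincides near
   y with the region strictly above the graph of phi. *)
Definition boundary_chart Omega (y : 'rV[R]_3) Q phi : Prop :=
  [/\ rotation Q, of_class_C 2 phi
    & exists2 r : R, 0 < r & forall x : 'rV[R]_3, enorm (x - y) < r ->
        Omega x <-> phi (col' ord_max (x *m Q)) < (x *m Q) 0 ord_max].

Definition C2_boundary Omega : Prop :=
  forall y, boundary Omega y -> exists Q phi, boundary_chart Omega y Q phi.

(* Fundamental forms of the graph of phi in the basis (e_i, d_i phi) of its
   tangent plane, with respect to the upward unit normal
   (- grad phi, 1) / sqrt (1 + |grad phi|^2). *)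
Definition first_form phi (t : 'rV[R]_2) : 'M[R]_2 :=
  1%:M + (gradient phi t)^T *m gradient phi t.

Definition second_form phi (t : 'rV[R]_2) : 'M[R]_2 :=
  (Num.sqrt (1 + enorm (gradient phi t) ^+ 2))^-1 *: hessian phi t.

Definition shape_operator phi (t : 'rV[R]_2) : 'M[R]_2 :=
  invmx (first_form phi t) *m second_form phi t.

(* k1, k2 are the eigenvalues, with multiplicity, of the shape operator of the
   boundary at y. The normal points into Omega, so that they are nonnegative
   for convex Omega; they depend on the chart only up to their order. *)
Definition principal_curvatures Omega (y : 'rV[R]_3) (k1 k2 : R) : Prop :=
  exists Q phi, boundary_chart Omega y Q phi /\
    char_poly (shape_operator phi (col' ord_max (y *m Q))) =
      ('X - k1%:P) * ('X - k2%:P).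

Definition mean_curvature Omega (y : 'rV[R]_3) (H : R) : Prop :=
  exists k1 k2, principal_curvatures Omega y k1 k2 /\ H = k1 + k2.

Definition minimal_boundary Omega : Prop :=
  forall y, boundary Omega y -> mean_curvature Omega y 0.

(* The second curvature need not be listed: the relation
   [principal_curvatures] is symmetric in k1 and k2. *)
Definition kappa0 Omega : R :=
  inf [set a | exists y k1 k2, [/\ boundary Omega y,
                 principal_curvatures Omega y k1 k2 & a = `|k1|]].

End Surfaces.

Section Integration.
Context {R : realType}.
Local Open Scope ereal_scope.

(* The library's product measures live on iterated products, which [point3]
   identifies with R^3. *)
Definition lebesgue2 : set (measurableTypeR R * measurableTypeR R) -> \bar R :=
  lebesgue_measure \x lebesgue_measure.

HB.instance Definition _ := Measure.on lebesgue2.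

Definition lebesgue3 :
    set (measurableTypeR R * measurableTypeR R * measurableTypeR R) -> \bar R :=
  lebesgue2 \x lebesgue_measure.

HB.instance Definition _ := Measure.on lebesgue3.

Definition point3 (p : R * R * R) : 'rV[R]_3 :=
  (\row_(i < 3) [:: p.1.1; p.1.2; p.2]`_i)%R.

Definition integral3 (Omega : set 'rV[R]_3) (g : 'rV[R]_3 -> R) : \bar R :=
  \int[lebesgue3]_(p in point3 @^-1` Omega) (g (point3 p))%:E.

End Integration.

(* Main.v *)
(* With d the distance to the complement, u = sqrt d is a supersolution of
   - Lap u = (1 / (4 d^2) + kappa0^2) u, and the inequality is the ground state
   substitution for u. As d need not be differentiable, everything is done with
   finite differences. At a point x with nearest boundary point y, d(x + h v)^2 is
   at most the squared distance from x + h v to the boundary point above t + h w,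
   where w is (1 + K) times the tangential part of v and K is d times the shape
   operator at y. This bound has an explicit second-order expansion; summing over
   an orthonormal frame gives 1 - tr K - tr K^2 - tr K^3, which for a minimal
   surface is 1 - 2 kappa^2 d^2. Hence the discrete Laplacian of u satisfies the
   differential inequality up to o(1). The discrete ground state inequality is
   integrated by translation invariance of Lebesgue measure, and the step tends
   to 0 by dominated convergence. *)
Require Import Defs.
From HB Require Import structures.
From mathcomp Require Import all_boot all_order all_algebra.
From mathcomp Require Import all_classical all_reals all_analysis.
From mathcomp Require Import measurable_realfun ring lra.
Set Implicit Arguments.
Unset Strict Implicit.
Unset Printing Implicit Defensive.
Import Order.TTheory GRing.Theory Num.Theory.
Import numFieldNormedType.Exports.
Local Open Scope classical_set_scope.
Local Open Scope ring_scope.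

(** The square root is the ground state behind the constant 1/4: on a half-line, sqrt t solves - u''
    = u / (4 t^2). Where d is smooth, - (Lap u) / u = 1 / (4 d^2) - (Lap d) / (2 d) for u = sqrt d,
    while half of Lap d^2 is 1 + d Lap d; bounding the latter by 1 - 2 kappa^2 d^2 therefore
    contributes exactly kappa^2.

    The obstacle is the cut locus. A function that lies above d^2 and touches it at x is enough
    there, since replacing d^2 by it can only raise the discrete Laplacian of u, which is to be
    bounded from above. Any motion of the foot point gives such a function. The optimal one is (1 -
    K)^-1 on the tangential part, which breaks down at a focal point, where K has the eigenvalue 1.
    Its truncation 1 + K needs no inverse, and cuts the optimal value 1 - tr (K + K^2 + K^3 + ...)
    after the third power. With eigenvalues of K opposite to each other, the odd traces vanish, so
    that nothing of the constant is lost. *)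

Ltac cvg_arith :=
  repeat (cbv beta; lazymatch goal with
  | |- cvg_to (nbhs (fmap (fun h => (@?f h + @?g h)%R) _)) _ =>
      apply: (@cvgD _ _ _ _ _ f g)
  | |- cvg_to (nbhs (fmap (fun h => (@?f h * @?g h)%R) _)) _ =>
      apply: (@cvgM _ _ _ _ f g)
  | |- cvg_to (nbhs (fmap (fun=> ?k) _)) _ => exact: cvg_cst
  | |- _ => assumption
  end).

(** * Second-order expansions at 0 of functions of one variable *)

Section Expansion.
Context {R : realType}.
Implicit Types (f g : R -> R) (a b c : R).

(** A Peano remainder. The identity is exact for every h, so that expansions are combined by ring
    identities, and only the limit of [e] concerns the punctured neighbourhood; the value [e 0] is
    free. *)
Definition expands f a b c : Prop :=
  exists2 e : R -> R, e @ (0 : R)^' --> (0 : R) &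
    forall h, f h = a + b * h + (c + e h) * h ^+ 2.

Lemma cvg_eq (F : set_system R) (f : R -> R) a b :
  f @ F --> a -> a = b -> f @ F --> b.
Proof. by move=> Fa <-. Qed.

Lemma cvg_dnbhs0 : (id : R -> R) @ (0 : R)^' --> (0 : R).
Proof. exact: (@nbhs_dnbhs R 0). Qed.

Lemma expands_affine a b : expands (fun h => a + b * h) a b 0.
Proof.
by exists (fun=> 0); [exact: cvg_cst | move=> h; rewrite addr0 mul0r addr0].
Qed.

Lemma expands_coef f a b c a' b' c' :
  expands f a b c -> a = a' -> b = b' -> c = c' -> expands f a' b' c'.
Proof. by move=> ? <- <- <-. Qed.

Lemma expandsD f g a b c a' b' c' : expands f a b c -> expands g a' b' c' ->
  expands (fun h => f h + g h) (a + a') (b + b') (c + c').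
Proof.
move=> [e e0 fE] [e' e'0 gE]; exists (fun h => e h + e' h).
  have H : (fun h => e h + e' h) @ (0 : R)^' --> (0 + 0 : R) by cvg_arith.
  by apply: cvg_eq H _; rewrite addr0.
by move=> h; rewrite fE gE; ring.
Qed.

Lemma expandsM f g a b c a' b' c' : expands f a b c -> expands g a' b' c' ->
  expands (fun h => f h * g h)
    (a * a') (a * b' + b * a') (a * c' + b * b' + c * a').
Proof.
move=> [e e0 fE] [e' e'0 gE].
exists (fun h => a * e' h + a' * e h + h * (b * (c' + e' h) + b' * (c + e h))
                 + h * h * ((c + e h) * (c' + e' h))).
  have h0 := cvg_dnbhs0.
  have k (z : R) : (fun=> z) @ (0 : R)^' --> z by exact: cvg_cst.
  have H : (fun h => a * e' h + a' * e h + h * (b * (c' + e' h) + b' * (c + e h))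
                 + h * h * ((c + e h) * (c' + e' h))) @ (0 : R)^' -->
     (a * 0 + a' * 0 + 0 * (b * (c' + 0) + b' * (c + 0))
                 + 0 * 0 * ((c + 0) * (c' + 0)) : R).
    by cvg_arith.
  by apply: cvg_eq H _; ring.
by move=> h; rewrite fE gE; ring.
Qed.

Lemma expandsN_arg f a b c : expands f a b c ->
  expands (fun h => f (- h)) a (- b) c.
Proof.
move=> [e e0 fE]; exists (fun h => e (- h)); last first.
  by move=> h; rewrite fE; ring.
apply: cvg_comp e0 => A; rewrite -[in X in X -> _]oppr0 dnbhsN => -[B HB <-].
by apply: filterS HB => h Bh; exists h.
Qed.

Lemma expands_cvg f a b c : expands f a b c -> f @ (0 : R)^' --> a.
Proof.
move=> [e e0 fE].
have h0 := cvg_dnbhs0.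
have k (z : R) : (fun=> z) @ (0 : R)^' --> z by exact: cvg_cst.
have H : (fun h => a + b * h + (c + e h) * (h * h)) @ (0 : R)^' -->
         (a + b * 0 + (c + 0) * (0 * 0) : R).
  by cvg_arith.
rewrite (_ : f = fun h => a + b * h + (c + e h) * (h * h)) ?funeqE //.
by apply: cvg_eq H _; ring.
Qed.

Lemma expands_sqrt f a b c : 0 < a -> expands f a b c ->
  expands (fun h => Num.sqrt (f h)) (Num.sqrt a) (b / (2 * Num.sqrt a))
    ((c - (b / (2 * Num.sqrt a)) ^+ 2) / (2 * Num.sqrt a)).
Proof.
move=> a0 Hf; have fa := expands_cvg Hf; case: Hf => e e0 fE.
have s0 : 0 < Num.sqrt a by rewrite sqrtr_gt0.
set al := Num.sqrt a in s0 *; set be := b / _; set ga := (_ / _).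
(* Rationalisation: multiplied by its conjugate, sqrt f - (al + be h) becomes f - (al + be h)^2 = (c
   - be^2 + e h) h^2, and the conjugate tends to 2 al, which is nonzero. *)
pose G h := (c - be ^+ 2 + e h) / (Num.sqrt (f h) + (al + be * h)) - ga.
exists (fun h => (Num.sqrt (f h) - al - be * h) / h ^+ 2 - ga); last first.
  move=> h; have [->|h0] := eqVneq h 0; last by field.
  by rewrite fE !(mulr0, addr0, expr0n) /=.
have h0 := cvg_dnbhs0.
have k (z : R) : (fun=> z) @ (0 : R)^' --> z by exact: cvg_cst.
have sf : (fun h => Num.sqrt (f h)) @ (0 : R)^' --> al.
  by apply: cvg_comp fa _; exact: sqrt_continuous.
have den : (fun h => Num.sqrt (f h) + (al + be * h)) @ (0 : R)^' --> al + (al + be * 0).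
  by cvg_arith.
have den0 : al + (al + be * 0) != 0 by rewrite mulr0 addr0 gt_eqF // addr_gt0.
have G0 : G @ (0 : R)^' --> (0 : R).
  have Vden : (fun h => (Num.sqrt (f h) + (al + be * h))^-1) @ (0 : R)^' -->
      (al + (al + be * 0))^-1 by exact: cvgV.
  have H : G @ (0 : R)^' --> (c - be ^+ 2 + 0) / (al + (al + be * 0)) - ga.
    by rewrite /G; cvg_arith.
  by apply: cvg_eq H _; rewrite /ga mulr0 !addr0 mulr_natl mulr2n subrr.
apply: cvg_trans G0; apply: near_eq_cvg.
near=> h.
have hn0 : h != 0 by near: h; exact: nbhs_dnbhs_neq.
have fh0 : 0 < f h by near: h; exact: (cvgr_gt _ fa).
have dh0 : Num.sqrt (f h) + (al + be * h) != 0.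
  by near: h; exact: (cvgr_neq0 _ den).
rewrite /G; congr (_ - _).
have E : Num.sqrt (f h) ^+ 2 = f h by rewrite sqr_sqrtr // ltW.
have E' : al ^+ 2 = a by rewrite sqr_sqrtr // ltW.
have Eb : b = 2 * al * be by rewrite /be; field; rewrite gt_eqF.
apply/eqP; rewrite eqr_div ?expf_neq0 //; apply/eqP.
have E3 : Num.sqrt (f h) ^+ 2 = al ^+ 2 + 2 * al * be * h + (c + e h) * h ^+ 2.
  by rewrite E E' -Eb fE.
have -> : (c - be ^+ 2 + e h) * h ^+ 2 =
   al ^+ 2 + 2 * al * be * h + (c + e h) * h ^+ 2 - (al + be * h) ^+ 2 by ring.
by rewrite -E3 subr_sqr; ring.
Unshelve. all: by end_near. Qed.

(** Fermat's rule: b + (c + e h) h has the sign of h near 0, so its limit b is both nonnegative and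
    nonpositive. Applied to the squared distance from x to boundary points, it makes x - y normal to
    the boundary. *)
Lemma expands_min f a b c : expands f a b c ->
  (\forall h \near (0 : R)^', a <= f h) -> b = 0.
Proof.
move=> [e e0 fE] mf.
have h0 := cvg_dnbhs0.
have k (z : R) : (fun=> z) @ (0 : R)^' --> z by exact: cvg_cst.
have L : (fun h => b + (c + e h) * h) @ (0 : R)^' --> (b + (c + 0) * 0 : R).
  by cvg_arith.
have {}L := cvg_eq L (etrans (congr1 (+%R b) (mulr0 _)) (addr0 b)).
have mR : \forall h \near (0 : R)^'+, a <= f h.
  move: mf; rewrite !near_withinE; apply: filterS => h H h_gt0.
  by apply: H; rewrite gt_eqF.
have mL : \forall h \near (0 : R)^'-, a <= f h.
  move: mf; rewrite !near_withinE; apply: filterS => h H h_lt0.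
  by apply: H; rewrite lt_eqF.
have bR : 0 <= b.
  apply: (cvgr_to_ge (cvg_dnbhs_at_right L)); near=> h.
  have h_gt0 : 0 < h by near: h; exact: nbhs_right_gt.
  have : a <= f h by near: h.
  by rewrite fE; nra.
have bL : b <= 0.
  apply: (cvgr_to_le (cvg_dnbhs_at_left L)); near=> h.
  have h_lt0 : h < 0 by near: h; exact: nbhs_left_lt.
  have : a <= f h by near: h.
  by rewrite fE; nra.
by apply/eqP; rewrite eq_le bL bR.
Unshelve. all: by end_near. Qed.

Lemma expands_uniq f a b c a' b' c' : expands f a b c -> expands f a' b' c' ->
  b = b' -> c = c'.
Proof.
move=> [e e0 fE] [e' e'0 fE'] bb'.
have k (z : R) : (fun=> z) @ (0 : R)^' --> z by exact: cvg_cst.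
have L : (fun h => c' + e' h) @ (0 : R)^' --> (c' + 0 : R) by cvg_arith.
have L' : (fun h => c + e h) @ (0 : R)^' --> (c + 0 : R) by cvg_arith.
rewrite -[c]addr0 -[c']addr0; apply: (cvg_unique _ _ L) => //.
apply: cvg_trans L'; apply: near_eq_cvg; near=> h.
have h0 : h != 0 by near: h; exact: nbhs_dnbhs_neq.
have := fE 0; rewrite fE' expr0n /= !mulr0 !addr0 => aa'.
have := fE h; rewrite fE' aa' bb' => /addrI.
by move/(mulIf (expf_neq0 2 h0)).
Unshelve. all: by end_near. Qed.

End Expansion.

(** * Taylor's formula for functions with continuous second partial derivatives *)

Section Taylor.
Context {R : realType}.

Lemma is_derive_continuous (g dg : R -> R) :
  (forall r : R, is_derive r (1 : R) g (dg r)) -> continuous g.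
Proof.
move=> dgP r; apply: differentiable_continuous.
by apply/derivable1_diffP; case: (dgP r).
Qed.

Lemma mean_value (g dg : R -> R) (s : R) :
  (forall r : R, is_derive r (1 : R) g (dg r)) ->
  exists2 r, `|r| <= `|s| & g s = g 0 + s * dg r.
Proof.
move=> dgP; have gc := is_derive_continuous dgP.
case: (leP 0 s) => [s0|/ltW s0].
  have [r /itvP rs E] := @MVT_segment R g dg 0 s s0 (fun x _ => dgP x)
    (continuous_subspaceT gc).
  exists r; first by rewrite !ger0_norm ?rs.
  by rewrite -[LHS](subrK (g 0)) E subr0 mulrC addrC.
have [r /itvP rs E] := @MVT_segment R g dg s 0 s0 (fun x _ => dgP x)
    (continuous_subspaceT gc).
exists r; first by rewrite !ler0_norm ?lerN2 ?rs.
rewrite -[LHS](subrK (g 0)) -[X in X + _]opprB E sub0r; ring.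
Qed.

(** The point must differ from s, because the derivative to which [taylor2] applies this has the
    factor s - r. *)
Lemma Rolle_sym (g dg : R -> R) (s : R) : s != 0 ->
  (forall r : R, is_derive r (1 : R) g (dg r)) -> g 0 = g s ->
  exists r, [/\ `|r| <= `|s|, r != s & dg r = 0].
Proof.
move=> s0 dgP gs; have gc := is_derive_continuous dgP.
have gd x : derivable g x (1 : R) by case: (dgP x).
have [s_gt0|s_lt0|/esym/eqP] := ltgtP 0 s; last by rewrite (negPf s0).
  have [r rs] := Rolle s_gt0 (fun x _ => gd x) (continuous_subspaceT gc) gs.
  move=> E; exists r; split.
  - by rewrite !ger0_norm ?(itvP rs).
  - by rewrite lt_eqF ?(itvP rs).
  - by rewrite -(@derive_val _ _ _ _ _ _ _ (dgP r)) (@derive_val _ _ _ _ _ _ _ E).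
have [r rs] := Rolle s_lt0 (fun x _ => gd x) (continuous_subspaceT gc) (esym gs).
move=> E; exists r; split.
- by rewrite !ler0_norm ?lerN2 ?(itvP rs).
- by rewrite gt_eqF ?(itvP rs).
- by rewrite -(@derive_val _ _ _ _ _ _ _ (dgP r)) (@derive_val _ _ _ _ _ _ _ E).
Qed.

Lemma taylor2 (g g1 g2 : R -> R) (s : R) :
  (forall r : R, is_derive r (1 : R) g (g1 r)) -> (forall r : R, is_derive r (1 : R) g1 (g2 r)) ->
  exists2 r, `|r| <= `|s| & g s = g 0 + s * g1 0 + s ^+ 2 / 2 * g2 r.
Proof.
move=> dg dg1; have [->|s0] := eqVneq s 0.
  by exists 0 => //; rewrite expr0n /= !mul0r !addr0.
(* [K] is dictated by G 0 = G s. In the derivative of [G] the terms in [g1] cancel, which leaves (s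
   - r) (g2 r - 2 K). *)
pose K := (g s - g 0 - s * g1 0) / s ^+ 2.
pose G r := g r + (s - r) * g1 r + K * (s - r) ^+ 2.
have dG (r : R) : is_derive r (1 : R) G ((s - r) * (g2 r - 2 * K)).
  have dgr := dg r; have dg1r := dg1 r.
  apply: is_derive_eq.
  rewrite /GRing.scale /=; ring.
have G0s : G 0 = G s.
  by rewrite /G /K !subr0 subrr; field.
have [r [rs rns]] := Rolle_sym s0 dG G0s.
move=> /eqP; rewrite mulf_eq0 subr_eq0 eq_sym (negPf rns) /= subr_eq0 => /eqP E.
by exists r => //; rewrite E /K; field.
Qed.

Variable n : nat.
Implicit Types (psi : 'rV[R]_n.+1 -> R) (x v : 'rV[R]_n.+1).

Lemma is_derive_line psi x v : (forall y, derivable psi y v) ->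
  forall r : R, is_derive r (1 : R) (fun s => psi (x + s *: v)) ('D_v psi (x + r *: v)).
Proof.
move=> dpsi r.
have E : (fun h : R => h^-1 *: (((fun s => psi (x + s *: v)) \o shift r) (h *: 1)
            - psi (x + r *: v))) =
         (fun h => h^-1 *: ((psi \o shift (x + r *: v)) (h *: v) - psi (x + r *: v))).
  apply/funext => h /=; congr (_ *: (psi _ - _)).
  by rewrite [h *: 1]mulr1 scalerDl addrCA.
by apply: DeriveDef; [rewrite /derivable E; exact: dpsi | rewrite /derive E].
Qed.

Lemma taylor1_line psi x v (s : R) : (forall y, derivable psi y v) ->
  exists2 r : R, `|r| <= `|s| &
    psi (x + s *: v) = psi x + s * 'D_v psi (x + r *: v).
Proof.
move=> dpsi; have [r rs] := mean_value s (is_derive_line x dpsi).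
by rewrite scale0r addr0; exists r.
Qed.

Lemma taylor2_line psi x v (s : R) : (forall y, derivable psi y v) ->
  (forall y, derivable ('D_v psi) y v) ->
  exists2 r : R, `|r| <= `|s| &
    psi (x + s *: v) =
      psi x + s * 'D_v psi x + s ^+ 2 / 2 * 'D_v ('D_v psi) (x + r *: v).
Proof.
move=> dpsi ddpsi.
have [r rs] := taylor2 s (is_derive_line x dpsi) (is_derive_line x ddpsi).
by rewrite scale0r addr0; exists r.
Qed.

Lemma cvg_le_mul (r : R -> R) (a : R) :
  (forall h, `|r h| <= `|h * a|) -> r @ (0 : R)^' --> (0 : R).
Proof.
move=> rh; apply: norm_cvg0.
have k (z : R) : (fun=> z) @ (0 : R)^' --> z by exact: cvg_cst.
have h0 := @cvg_dnbhs0 R.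
have L : (fun h => h * a) @ (0 : R)^' --> (0 * a : R) by cvg_arith.
have {}L : (fun h => `|h * a|) @ (0 : R)^' --> (0 : R).
  by apply: cvg_eq (cvg_norm L) _; rewrite mul0r normr0.
by apply: squeeze_cvgr (k 0) L; near=> h; rewrite normr_ge0 rh.
Unshelve. all: by end_near. Qed.

Lemma cvg0_lin3 (k1 k2 k3 l1 l2 l3 : R) (q1 q2 q3 : R -> R) :
  q1 @ (0 : R)^' --> l1 -> q2 @ (0 : R)^' --> l2 -> q3 @ (0 : R)^' --> l3 ->
  (fun h => k1 * (q1 h + - l1) + k2 * (q2 h + - l2) + k3 * (q3 h + - l3))
    @ (0 : R)^' --> (0 : R).
Proof.
move=> L1 L2 L3.
have H : (fun h => k1 * (q1 h + - l1) + k2 * (q2 h + - l2) + k3 * (q3 h + - l3))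
    @ (0 : R)^' -->
    (k1 * (l1 + - l1) + k2 * (l2 + - l2) + k3 * (l3 + - l3) : R) by cvg_arith.
by apply: cvg_eq H _; rewrite !subrr !mulr0 !addr0.
Qed.

Lemma path_eq (a b h F F1 F0 y pi pj A A0 B B0 D D0 : R) :
  F = F1 + h * b * y + (h * b) ^+ 2 / 2 * D -> y = pj + h * a * B ->
  F1 = F0 + h * a * pi + (h * a) ^+ 2 / 2 * A ->
  F = F0 + (a * pi + b * pj) * h + (a ^+ 2 / 2 * A0 + a * b * B0 + b ^+ 2 / 2 * D0
    + (a ^+ 2 / 2 * (A + - A0) + a * b * (B + - B0) + b ^+ 2 / 2 * (D + - D0)))
      * h ^+ 2.
Proof. by move=> -> -> ->; field. Qed.

(** Only partial derivatives are given, so the increment is split into two legs parallel to the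
    axes: order two along each leg, and order one for [partial j psi] along the first. The
    intermediate points tend to t, and continuity of the second partial derivatives turns the
    Lagrange remainders into a Peano one. *)
Lemma expands_path psi t (i j : 'I_n.+1) (a b : R) : of_class_C 2 psi ->
  expands (fun h => psi (t + (h * a) *: delta_mx 0 i + (h * b) *: delta_mx 0 j))
    (psi t) (a * partial i psi t + b * partial j psi t)
    (a ^+ 2 / 2 * partials [:: i; i] psi t + a * b * partials [:: i; j] psi t
     + b ^+ 2 / 2 * partials [:: j; j] psi t).
Proof.
move=> [dpsi cpsi].
set u := delta_mx 0 i; set v := delta_mx 0 j.
have /choice[r1 r1P] h : exists r : R, `|r| <= `|h * a| /\
    psi (t + (h * a) *: u) = psi t + (h * a) * partial i psi t
      + (h * a) ^+ 2 / 2 * partials [:: i; i] psi (t + r *: u).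
  have [//||r] := @taylor2_line psi t u (h * a); last by exists r.
  - exact: (dpsi [::] erefl i).
  - exact: (dpsi [:: i] erefl i).
have /choice[r2 r2P] h : exists r : R, `|r| <= `|h * a| /\
    partial j psi (t + (h * a) *: u) = partial j psi t
      + (h * a) * partials [:: i; j] psi (t + r *: u).
  have [|r] := @taylor1_line (partial j psi) t u (h * a); last by exists r.
  exact: (dpsi [:: j] erefl i).
have /choice[r3 r3P] h : exists r : R, `|r| <= `|h * b| /\
    psi (t + (h * a) *: u + (h * b) *: v) =
      psi (t + (h * a) *: u) + (h * b) * partial j psi (t + (h * a) *: u)
      + (h * b) ^+ 2 / 2 * partials [:: j; j] psi (t + (h * a) *: u + r *: v).
  have [//||r] := @taylor2_line psi (t + (h * a) *: u) v (h * b); last by exists r.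
  - exact: (dpsi [::] erefl j).
  - exact: (dpsi [:: j] erefl j).
have h0 := @cvg_dnbhs0 R.
have k (z : R) : (fun=> z) @ (0 : R)^' --> z by exact: cvg_cst.
have lim (s : seq 'I_n.+1) (q1 q2 : R -> R) : (size s <= 2)%N ->
    q1 @ (0 : R)^' --> (0 : R) -> q2 @ (0 : R)^' --> (0 : R) ->
    (fun h => partials s psi (t + q1 h *: u + q2 h *: v)) @ (0 : R)^' -->
    partials s psi t.
  move=> s2 q10 q20; apply: (@cvg_comp _ _ _ (fun h => t + q1 h *: u + q2 h *: v) _ _ _ _ _
    (cpsi s s2 t)).
  have {2}-> : t = t + 0 *: u + 0 *: v by rewrite !scale0r !addr0.
  by apply: cvgD; [apply: cvgD; [exact: cvg_cst|]|]; apply: cvgZr_tmp.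
have l0 (s : seq 'I_n.+1) (q : R -> R) : (size s <= 2)%N ->
    q @ (0 : R)^' --> (0 : R) ->
    (fun h => partials s psi (t + q h *: u)) @ (0 : R)^' --> partials s psi t.
  move=> s2 q0; have := lim s q (fun=> 0) s2 q0 (k 0).
  by under eq_fun do rewrite scale0r addr0.
have L1 := l0 [:: i; i] r1 erefl (cvg_le_mul (fun h => (r1P h).1)).
have L2 := l0 [:: i; j] r2 erefl (cvg_le_mul (fun h => (r2P h).1)).
have L3 : (fun h => partials [:: j; j] psi (t + (h * a) *: u + r3 h *: v)) @
    (0 : R)^' --> partials [:: j; j] psi t.
  apply: lim => //; last exact: (cvg_le_mul (fun h => (r3P h).1)).
  exact: (@cvg_le_mul _ a).
exists (fun h =>
    a ^+ 2 / 2 * (partials [:: i; i] psi (t + r1 h *: u) + - partials [:: i; i] psi t)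
  + a * b * (partials [:: i; j] psi (t + r2 h *: u) + - partials [:: i; j] psi t)
  + b ^+ 2 / 2 * (partials [:: j; j] psi (t + (h * a) *: u + r3 h *: v)
                  + - partials [:: j; j] psi t)).
  exact: (cvg0_lin3 (a ^+ 2 / 2) (a * b) (b ^+ 2 / 2) L1 L2 L3).
by move=> h; exact: (path_eq _ _ _ (r3P h).2 (r2P h).2 (r1P h).2).
Qed.

(** Schwarz's theorem: for a = b = 1 the two orders of the legs reach the same point, so the two
    quadratic coefficients agree, and they share their diagonal terms. *)
Lemma partials_sym psi t (i j : 'I_n.+1) : of_class_C 2 psi ->
  partials [:: i; j] psi t = partials [:: j; i] psi t.
Proof.
move=> C2.
have E1 := expands_path t i j 1 1 C2.
have E2 := expands_path t j i 1 1 C2.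
have E : (fun h : R => psi (t + (h * 1) *: delta_mx 0 i + (h * 1) *: delta_mx 0 j))
    = (fun h => psi (t + (h * 1) *: delta_mx 0 j + (h * 1) *: delta_mx 0 i)).
  by apply/funext => h; rewrite addrAC.
rewrite E in E1.
have cross (A B B' D : R) : 1 ^+ 2 / 2 * A + 1 * 1 * B + 1 ^+ 2 / 2 * D =
  1 ^+ 2 / 2 * D + 1 * 1 * B' + 1 ^+ 2 / 2 * A -> B = B' by lra.
exact: (cross _ _ _ _ (expands_uniq E1 E2 (addrC _ _))).
Qed.

End Taylor.

(** * The Euclidean norm on row vectors *)

Section EuclideanNorm.
Context {R : realType} {n : nat}.
Implicit Types u v x y z : 'rV[R]_n.

Lemma enorm_ge0 v : 0 <= enorm v.
Proof. exact: sqrtr_ge0. Qed.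

Lemma sqr_enorm v : enorm v ^+ 2 = \sum_i v 0 i ^+ 2.
Proof. by rewrite sqr_sqrtr // sumr_ge0 // => i _; exact: sqr_ge0. Qed.

Lemma enorm0 : enorm (0 : 'rV[R]_n) = 0.
Proof.
by rewrite /enorm big1 ?sqrtr0 // => i _; rewrite mxE expr0n.
Qed.

Lemma enormZ (a : R) v : enorm (a *: v) = `|a| * enorm v.
Proof.
rewrite /enorm -sqrtr_sqr -sqrtrM ?sqr_ge0 // mulr_sumr.
by congr Num.sqrt; apply: eq_bigr => i _; rewrite mxE exprMn.
Qed.

Lemma enormN v : enorm (- v) = enorm v.
Proof. by rewrite -scaleN1r enormZ normrN normr1 mul1r. Qed.

Lemma norm_coord_le v i : `|v 0 i| <= enorm v.
Proof.
rewrite -sqrtr_sqr ler_sqrt ?sumr_ge0 // => [|j _]; last exact: sqr_ge0.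
by rewrite (bigD1 i) //= lerDl sumr_ge0 // => j _; exact: sqr_ge0.
Qed.

Lemma enorm_eq0 v : enorm v = 0 -> v = 0.
Proof.
move=> v0; apply/rowP => i; rewrite mxE; apply/eqP.
by rewrite -normr_le0 -v0 norm_coord_le.
Qed.

Lemma Cauchy_Schwarz u v : \sum_i u 0 i * v 0 i <= enorm u * enorm v.
Proof.
have [/enorm_eq0 ->|u0] := eqVneq (enorm u) 0.
  by rewrite enorm0 mul0r big1 // => i _; rewrite mxE mul0r.
have [/enorm_eq0 ->|v0] := eqVneq (enorm v) 0.
  by rewrite enorm0 mulr0 big1 // => i _; rewrite mxE mulr0.
have {}u0 : 0 < enorm u by rewrite lt_def u0 enorm_ge0.
have {}v0 : 0 < enorm v by rewrite lt_def v0 enorm_ge0.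
have : 0 <= \sum_i (enorm v / enorm u * u 0 i - v 0 i) ^+ 2.
  by rewrite sumr_ge0 // => i _; exact: sqr_ge0.
have -> : \sum_i (enorm v / enorm u * u 0 i - v 0 i) ^+ 2 =
    (enorm v / enorm u) ^+ 2 * \sum_i u 0 i ^+ 2
    - 2 * (enorm v / enorm u) * (\sum_i u 0 i * v 0 i) + \sum_i v 0 i ^+ 2.
  rewrite !mulr_sumr -sumrN -!big_split /=.
  by apply: eq_bigr => i _; ring.
rewrite -!sqr_enorm; set c := \sum_i _.
have -> : (enorm v / enorm u) ^+ 2 * enorm u ^+ 2 -
    2 * (enorm v / enorm u) * c + enorm v ^+ 2 =
    2 * enorm v * (enorm u * enorm v - c) / enorm u by field; rewrite gt_eqF.
by rewrite pmulr_lge0 ?invr_gt0 // pmulr_rge0 ?subr_ge0 // mulr_gt0.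
Qed.

Lemma enormD u v : enorm (u + v) <= enorm u + enorm v.
Proof.
rewrite -(@ler_pXn2r _ 2) ?nnegrE ?addr_ge0 ?enorm_ge0 //.
rewrite sqrrD !sqr_enorm.
have -> : \sum_i (u + v) 0 i ^+ 2 =
    \sum_i u 0 i ^+ 2 + (\sum_i u 0 i * v 0 i) *+ 2 + \sum_i v 0 i ^+ 2.
  by rewrite -sumrMnl -!big_split; apply: eq_bigr => i _; rewrite mxE /=; ring.
by rewrite lerD2r lerD2l lerMn2r Cauchy_Schwarz.
Qed.

Lemma enorm_continuous : continuous (@enorm R n).
Proof.
have c (s : seq 'I_n) : continuous (fun v : 'rV[R]_n => \sum_(i <- s) v 0 i ^+ 2).
  elim: s => [|i s IHs] x.
    rewrite (_ : (fun _ => _) = cst 0); first exact: cst_continuous.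
    by apply/funext => v; rewrite big_nil.
  rewrite (_ : (fun _ => _) =
      (fun v => v 0 i ^+ 2) + (fun v => \sum_(i <- s) v 0 i ^+ 2)); last first.
    by apply/funext => v; rewrite big_cons.
  apply: continuousD; last exact: IHs.
  apply: (@continuous_comp 'rV[R]_n R R (fun v => v 0 i) (fun r => r ^+ 2)).
    exact: coord_continuous.
  exact: exprn_continuous.
move=> x; apply: (@continuous_comp 'rV[R]_n R R
  (fun v => \sum_i v 0 i ^+ 2) Num.sqrt); first exact: c.
exact: sqrt_continuous.
Qed.

Lemma enormB_continuous x : continuous (fun y : 'rV[R]_n => enorm (x - y)).
Proof.
move=> y; apply: (@continuous_comp 'rV[R]_n 'rV[R]_n R (fun y => x - y)
  (@enorm R n)); last exact: enorm_continuous.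
apply: (@continuousB R 'rV[R]_n 'rV[R]_n (cst x) id); first exact: cst_continuous.
by move=> A; exact: id.
Qed.

Lemma norm_le_enorm v : `|v| <= enorm v.
Proof.
rewrite /Num.Def.normr /= mx_normrE; apply: bigmax_le => [|[i j] _] /=.
  exact: enorm_ge0.
by rewrite (ord1 i) norm_coord_le.
Qed.

End EuclideanNorm.

(** * Distance to the complement and nearest points *)

Section Distance.
Context {R : realType} {n : nat}.
Variable Omega : set 'rV[R]_n.+1.
Hypotheses (Omega_open : open Omega) (Omega_nT : ~` Omega !=set0).
Implicit Types x y z : 'rV[R]_n.+1.

Lemma dist_compl_le x z : ~ Omega z -> dist_compl Omega x <= enorm (x - z).
Proof.
move=> Oz; apply: ge_inf; last by exists z.
by exists 0 => _ [y _ <-]; exact: enorm_ge0.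
Qed.

Lemma dist_compl_attained x :
  exists2 y, ~ Omega y & enorm (x - y) = dist_compl Omega x.
Proof.
case: Omega_nT => z0 Oz0.
(* The complement may be unbounded. Cutting it by the closed ball through [z0] gives a compact set,
   and what is cut off is farther from x than [z0]. *)
pose A := ~` Omega `&` [set y | enorm (x - y) <= enorm (x - z0)].
have c := @enormB_continuous R n.+1 x.
have cA : compact A.
  apply: bounded_closed_compact.
    exists (`|x| + enorm (x - z0)); split; first exact: num_real.
    move=> M ltM y [_ /= le]; rewrite -[y](subKr x).
    apply: (le_trans (ler_normB _ _)); apply: le_trans (ltW ltM).
    by rewrite lerD2l (le_trans (norm_le_enorm _)).
  apply: closedI; first exact: open_closedC.
  apply: (@preimage_closed 'rV[R]_n.+1 R (fun y => enorm (x - y))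
    [set r | r <= enorm (x - z0)]); last exact: closed_le.
  by move=> y _; exact: c.
have A0 : A !=set0 by exists z0; split => //=.
have [y /set_mem[Oy /= _] ymin] := EVT_min_rV A0 cA (continuous_subspaceT c).
exists y => //; apply/eqP; rewrite eq_le dist_compl_le // andbT.
apply: lb_le_inf; first by exists (enorm (x - z0)); exists z0.
move=> _ [z Oz <-]; have [le|/ltW le] := leP (enorm (x - z)) (enorm (x - z0)).
  by apply: ymin; rewrite inE.
by apply: le_trans le; apply: ymin; rewrite inE; split => /=.
Qed.

Lemma dist_compl_ge0 x : 0 <= dist_compl Omega x.
Proof. by have [y _ <-] := dist_compl_attained x; exact: enorm_ge0. Qed.

Lemma dist_compl_gt0 x : Omega x -> 0 < dist_compl Omega x.
Proof.
move=> Ox; rewrite lt_def dist_compl_ge0 andbT; apply/eqP => d0.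
have [y Oy] := dist_compl_attained x; rewrite d0 => /enorm_eq0 /eqP.
by rewrite subr_eq0 => /eqP xy; apply: Oy; rewrite -xy.
Qed.

Lemma dist_compl_lip x z : dist_compl Omega x <= dist_compl Omega z + enorm (x - z).
Proof.
have [y Oy <-] := dist_compl_attained z.
rewrite (le_trans (dist_compl_le x Oy)) //.
by rewrite [leRHS]addrC -[x - y](subrKA z) enormD.
Qed.

Lemma dist_compl_continuous : continuous (dist_compl Omega).
Proof.
move=> x; apply/(@cvgrPdist_le _ _ _ _ (@nbhs_filter 'rV[R]_n.+1 x)) => e e0.
have c : (fun y => enorm (x - y)) @ x --> (0 : R).
  by have := @enormB_continuous R n.+1 x x; rewrite /continuous_at subrr enorm0.
have := @cvgr_le _ _ _ (@nbhs_filter 'rV[R]_n.+1 x) _ _ c _ e0; apply: filterS => y le.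
have := dist_compl_lip x y; have := dist_compl_lip y x.
rewrite -[y - x]opprB enormN => h1 h2; rewrite ler_norml; lra.
Qed.

(** Points of the open segment from y to x are closer to x than the complement is, hence lie in
    Omega, and they accumulate at y. *)
Lemma nearest_in_boundary x y : Omega x -> ~ Omega y ->
  enorm (x - y) = dist_compl Omega x -> boundary Omega y.
Proof.
move=> Ox Oy dE; split; last by move/interior_subset.
move=> B By.
have L : (fun s : R => y + s *: (x - y)) @ (0 : R)^'+ --> y + 0 *: (x - y).
  apply: cvgD; first exact: cvg_cst.
  by apply: cvgZr_tmp; exact: cvg_at_right_filter.
rewrite scale0r addr0 in L.
have d0 := dist_compl_gt0 Ox.
near (0 : R)^'+ => s; exists (y + s *: (x - y)); split; last first.
  by near: s; exact: (L _ By).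
apply: contrapT => /(dist_compl_le x); apply/negP; rewrite -ltNge -dE.
rewrite opprD addrA -{1}[x - y]scale1r -scalerBl enormZ dE.
have s0 : 0 < s by near: s; exact: nbhs_right_gt.
have s1 : s < 1 by near: s; exact: nbhs_right_lt.
rewrite ger0_norm ?subr_ge0 ?ltW // -[ltRHS]mul1r ltr_pM2r //; lra.
Unshelve. all: by end_near. Qed.

End Distance.

(** * Squared distance to a moving point of a graph *)

Section Barrier.
Context {R : realType}.

Lemma sum_ord3 (F : 'I_3 -> R) : \sum_i F i = F 0 + F 1 + F ord_max.
Proof.
by rewrite !big_ord_recr big_ord0 /= add0r; congr (F _ + F _ + F _); exact: val_inj.
Qed.

Lemma sqr_enorm3 (z : 'rV[R]_3) :
  enorm z ^+ 2 = z 0 0 ^+ 2 + z 0 1 ^+ 2 + z 0 ord_max ^+ 2.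
Proof. by rewrite sqr_enorm sum_ord3. Qed.

Lemma enorm_rotation n (Q : 'M[R]_n) (v : 'rV[R]_n) : Q *m Q^T = 1%:M ->
  enorm (v *m Q) = enorm v.
Proof.
have E (u : 'rV[R]_n) : enorm u = Num.sqrt ((u *m u^T) 0 0).
  congr Num.sqrt; rewrite mxE; apply: eq_bigr => i _.
  by rewrite mxE expr2.
by move=> QQ; rewrite !E trmx_mul mulmxA -(mulmxA v) QQ mulmx1.
Qed.

Lemma expands_graph (phi : 'rV[R]_2 -> R) (t w : 'rV[R]_2) : of_class_C 2 phi ->
  expands (fun h => phi (t + h *: w)) (phi t)
    (w 0 0 * partial 0 phi t + w 0 1 * partial 1 phi t)
    (w 0 0 ^+ 2 / 2 * partials [:: 0; 0] phi t
     + w 0 0 * w 0 1 * partials [:: 0; 1] phi t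
     + w 0 1 ^+ 2 / 2 * partials [:: 1; 1] phi t).
Proof.
move=> C2; have := expands_path t 0 1 (w 0 0) (w 0 1) C2.
congr (expands _ _ _ _); apply/funext => h; congr phi.
rewrite -addrA; congr (t + _); apply/rowP => j; rewrite !mxE.
have [->|->] : j = 0 \/ j = 1.
- by case: j => [[|[|//]] jP]; [left|right]; exact: val_inj.
- by rewrite !eqxx /= mulr1 mulr0 addr0.
- by rewrite !eqxx /= mulr1 mulr0 add0r.
Qed.

(* The squared distance from x + h d to the point of the graph above t0 + h w,
   in the rotated coordinates centered at the foot point. *)
Definition graph_gap (phi : 'rV[R]_2 -> R) (t w : 'rV[R]_2) (X v : 'rV[R]_3)
    (h : R) : R :=
  (X 0 0 + (v 0 0 - w 0 0) * h) ^+ 2 + (X 0 1 + (v 0 1 - w 0 1) * h) ^+ 2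
  + (X 0 ord_max + v 0 ord_max * h + -1 * (phi (t + h *: w) - phi t)) ^+ 2.

(** The coefficients of h and h^2 in [graph_gap], where (p, q) is the gradient of phi and a, m, d
    are the entries of its Hessian. They are functions of real numbers only, so that [ring] and
    [field] can handle them. *)
Definition gap_slope (p q w0 w1 X0 X1 X2 v0 v1 v2 : R) : R :=
  2 * (X0 * (v0 - w0) + X1 * (v1 - w1) + X2 * (v2 - (w0 * p + w1 * q))).

Definition gap_curv (p q a m d w0 w1 X2 v0 v1 v2 : R) : R :=
  (v0 - w0) ^+ 2 + (v1 - w1) ^+ 2 + (v2 - (w0 * p + w1 * q)) ^+ 2
  - 2 * X2 * (w0 ^+ 2 / 2 * a + w0 * w1 * m + w1 ^+ 2 / 2 * d).

Lemma expands_sqr_dist (g : R -> R) (g0 b c X0 X1 X2 u0 u1 v2 : R) :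
  expands g g0 b c ->
  expands (fun h => (X0 + u0 * h) ^+ 2 + (X1 + u1 * h) ^+ 2
      + (X2 + v2 * h + -1 * (g h - g0)) ^+ 2)
    (X0 ^+ 2 + X1 ^+ 2 + X2 ^+ 2) (2 * (X0 * u0 + X1 * u1 + X2 * (v2 - b)))
    (u0 ^+ 2 + u1 ^+ 2 + (v2 - b) ^+ 2 - 2 * X2 * c).
Proof.
move=> gE.
have E0 := expands_affine X0 u0.
have E1 := expands_affine X1 u1.
have E2 := expandsD (expands_affine X2 v2) (expandsM (expands_affine (-1) 0)
    (expandsD gE (expands_affine (- g0) 0))).
have := expandsD (expandsD (expandsM E0 E0) (expandsM E1 E1)) (expandsM E2 E2).
set F := (fun h => _) => H.
have -> : (fun h => (X0 + u0 * h) ^+ 2 + (X1 + u1 * h) ^+ 2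
      + (X2 + v2 * h + -1 * (g h - g0)) ^+ 2) = F.
  by apply/funext => h; rewrite /F; ring.
by apply: expands_coef H _ _ _; ring.
Qed.

Lemma expands_gap phi t w (X v : 'rV[R]_3) : of_class_C 2 phi ->
  expands (graph_gap phi t w X v) (enorm X ^+ 2)
   (gap_slope (partial 0 phi t) (partial 1 phi t) (w 0 0) (w 0 1)
     (X 0 0) (X 0 1) (X 0 ord_max) (v 0 0) (v 0 1) (v 0 ord_max))
   (gap_curv (partial 0 phi t) (partial 1 phi t) (partials [:: 0; 0] phi t)
     (partials [:: 0; 1] phi t) (partials [:: 1; 1] phi t) (w 0 0) (w 0 1)
     (X 0 ord_max) (v 0 0) (v 0 1) (v 0 ord_max)).
Proof.
move=> C2; rewrite sqr_enorm3.
exact: expands_sqr_dist (expands_graph t w C2).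
Qed.

End Barrier.

(** * Algebra of the second-order coefficient *)

Section BarrierAlgebra.
Context {R : realType}.

(** Trace of K = sg G^-1 Hess, with G the first fundamental form, and next its determinant. In the
    application [sg] is the last rotated coordinate of x - y and sg^2 (1 + p^2 + q^2) = d^2, so that
    K is d times the shape operator up to sign; for a minimal surface the trace is 0 and the
    determinant is even in [sg], which makes the sign immaterial. *)
Definition shape_trace (p q a m d sg : R) : R :=
  sg * ((1 + q ^+ 2) * a - 2 * p * q * m + (1 + p ^+ 2) * d) / (1 + p ^+ 2 + q ^+ 2).

Definition shape_det (p q a m d sg : R) : R :=
  sg ^+ 2 * (a * d - m ^+ 2) / (1 + p ^+ 2 + q ^+ 2).

(* Tangential coordinates of v in the basis (e_i, d_i phi). *)
Definition tang0 (p q v0 v1 v2 : R) : R :=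
  ((1 + q ^+ 2) * (v0 + p * v2) - p * q * (v1 + q * v2)) / (1 + p ^+ 2 + q ^+ 2).

Definition tang1 (p q v0 v1 v2 : R) : R :=
  ((1 + p ^+ 2) * (v1 + q * v2) - p * q * (v0 + p * v2)) / (1 + p ^+ 2 + q ^+ 2).

(* The foot point moves by (1 + K) applied to the tangential part of v, where
   K is sg times the inverse metric applied to the Hessian. *)
Definition foot0 (p q a m d sg v0 v1 v2 : R) : R :=
  tang0 p q v0 v1 v2 + sg / (1 + p ^+ 2 + q ^+ 2) *
   (((1 + q ^+ 2) * a - p * q * m) * tang0 p q v0 v1 v2
    + ((1 + q ^+ 2) * m - p * q * d) * tang1 p q v0 v1 v2).

Definition foot1 (p q a m d sg v0 v1 v2 : R) : R :=
  tang1 p q v0 v1 v2 + sg / (1 + p ^+ 2 + q ^+ 2) *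
   (((1 + p ^+ 2) * m - p * q * a) * tang0 p q v0 v1 v2
    + ((1 + p ^+ 2) * d - p * q * m) * tang1 p q v0 v1 v2).

Definition foot_curv (p q a m d sg v0 v1 v2 : R) : R :=
  gap_curv p q a m d (foot0 p q a m d sg v0 v1 v2) (foot1 p q a m d sg v0 v1 v2)
    sg v0 v1 v2.

(** If the foot point moves by W, the coefficient is |v_N|^2 + |v_T - W|^2 - <K W, W>, with v_N and
    v_T the normal and tangential parts of v. For W = (1 + K) v_T this is |v_N|^2 - <(K + K^2 + K^3)
    v_T, v_T>, and Newton's identities write its trace in terms of t and D. *)
Lemma foot_curv_basis (p q a m d sg : R) :
  let t := shape_trace p q a m d sg in let D := shape_det p q a m d sg in
  foot_curv p q a m d sg 1 0 0 + foot_curv p q a m d sg 0 1 0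
  + foot_curv p q a m d sg 0 0 1 = 1 - t - t ^+ 2 + 2 * D - t ^+ 3 + 3 * t * D.
Proof.
have D0 : 1 + p ^+ 2 + q ^+ 2 != 0.
  by rewrite gt_eqF // -addrA ltr_pwDl // addr_ge0 // sqr_ge0.
rewrite /foot_curv /gap_curv /foot0 /foot1 /tang0 /tang1 /shape_trace /shape_det.
by field.
Qed.

Definition lin3 (c0 c1 c2 v0 v1 v2 : R) : R := c0 * v0 + c1 * v1 + c2 * v2.

Lemma foot0_lin (p q a m d sg : R) : exists c0 c1 c2, forall v0 v1 v2,
  foot0 p q a m d sg v0 v1 v2 = lin3 c0 c1 c2 v0 v1 v2.
Proof.
exists (foot0 p q a m d sg 1 0 0), (foot0 p q a m d sg 0 1 0), (foot0 p q a m d sg 0 0 1).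
by move=> v0 v1 v2; rewrite /lin3 /foot0 /tang0 /tang1; ring.
Qed.

Lemma foot1_lin (p q a m d sg : R) : exists c0 c1 c2, forall v0 v1 v2,
  foot1 p q a m d sg v0 v1 v2 = lin3 c0 c1 c2 v0 v1 v2.
Proof.
exists (foot1 p q a m d sg 1 0 0), (foot1 p q a m d sg 0 1 0), (foot1 p q a m d sg 0 0 1).
by move=> v0 v1 v2; rewrite /lin3 /foot1 /tang0 /tang1; ring.
Qed.

(** The frame vectors are the rows, but the relation is that of the columns: equivalent for a square
    matrix, it is the form used by sums over the frame. *)
Definition orthonormal3 (v : 'I_3 -> 'I_3 -> R) : Prop :=
  forall j k, v 0 j * v 0 k + v 1 j * v 1 k + v ord_max j * v ord_max k = (j == k)%:R.

(** The trace of a quadratic form is the same in every frame. This carries [foot_curv_basis] from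
    the standard basis to the frame rotated by a chart. *)
Lemma orthonormal3_sum (v : 'I_3 -> 'I_3 -> R) (q00 q01 q02 q11 q12 q22 : R) :
  orthonormal3 v ->
  let B i := q00 * (v i 0 * v i 0) + q01 * (v i 0 * v i 1) + q02 * (v i 0 * v i ord_max)
    + q11 * (v i 1 * v i 1) + q12 * (v i 1 * v i ord_max)
    + q22 * (v i ord_max * v i ord_max) in
  B 0 + B 1 + B ord_max = q00 + q11 + q22.
Proof.
move=> vP.
have := (vP 0 0, vP 0 1, vP 0 ord_max, vP 1 1, vP 1 ord_max, vP ord_max ord_max).
rewrite !eqxx /= => -[] [] [] [] [] H0 H1 H2 H3 H4 H5.
transitivity (q00 * (v 0 0 * v 0 0 + v 1 0 * v 1 0 + v ord_max 0 * v ord_max 0) +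
  q01 * (v 0 0 * v 0 1 + v 1 0 * v 1 1 + v ord_max 0 * v ord_max 1) +
  q02 * (v 0 0 * v 0 ord_max + v 1 0 * v 1 ord_max + v ord_max 0 * v ord_max ord_max) +
  q11 * (v 0 1 * v 0 1 + v 1 1 * v 1 1 + v ord_max 1 * v ord_max 1) +
  q12 * (v 0 1 * v 0 ord_max + v 1 1 * v 1 ord_max + v ord_max 1 * v ord_max ord_max) +
  q22 * (v 0 ord_max * v 0 ord_max + v 1 ord_max * v 1 ord_max
    + v ord_max ord_max * v ord_max ord_max)); first by ring.
by rewrite H0 H1 H2 H3 H4 H5; ring.
Qed.

Lemma lin_gap_curv (p q a m d X2 b0 b1 b2 c0 c1 c2 : R) :
  exists q00 q01 q02 q11 q12 q22, forall v0 v1 v2,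
    gap_curv p q a m d (lin3 b0 b1 b2 v0 v1 v2) (lin3 c0 c1 c2 v0 v1 v2) X2 v0 v1 v2
    = q00 * (v0 * v0) + q01 * (v0 * v1) + q02 * (v0 * v2)
      + q11 * (v1 * v1) + q12 * (v1 * v2) + q22 * (v2 * v2).
Proof.
pose B v0 v1 v2 :=
  gap_curv p q a m d (lin3 b0 b1 b2 v0 v1 v2) (lin3 c0 c1 c2 v0 v1 v2) X2 v0 v1 v2.
(* Polarisation: the coefficients are read off from the values at basis vectors and at sums of two
   of them. *)
exists (B 1 0 0), (B 1 1 0 - B 1 0 0 - B 0 1 0), (B 1 0 1 - B 1 0 0 - B 0 0 1),
  (B 0 1 0), (B 0 1 1 - B 0 1 0 - B 0 0 1), (B 0 0 1).
by move=> v0 v1 v2; rewrite /B /gap_curv /lin3; field.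
Qed.

Lemma foot_curv_sum (p q a m d sg : R) (v : 'I_3 -> 'I_3 -> R) :
  orthonormal3 v -> shape_trace p q a m d sg = 0 ->
  foot_curv p q a m d sg (v 0 0) (v 0 1) (v 0 ord_max)
  + foot_curv p q a m d sg (v 1 0) (v 1 1) (v 1 ord_max)
  + foot_curv p q a m d sg (v ord_max 0) (v ord_max 1) (v ord_max ord_max)
  = 1 + 2 * shape_det p q a m d sg.
Proof.
move=> vP t0.
have E := foot_curv_basis p q a m d sg; rewrite /= t0 in E.
have {E}-> : 1 + 2 * shape_det p q a m d sg =
  foot_curv p q a m d sg 1 0 0 + foot_curv p q a m d sg 0 1 0
  + foot_curv p q a m d sg 0 0 1 by rewrite E; ring.
have [b0 [b1 [b2 bE]]] := foot0_lin p q a m d sg.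
have [c0 [c1 [c2 cE]]] := foot1_lin p q a m d sg.
have [q00 [q01 [q02 [q11 [q12 [q22 qE]]]]]] := lin_gap_curv p q a m d sg b0 b1 b2 c0 c1 c2.
rewrite /foot_curv !bE !cE !qE.
rewrite (orthonormal3_sum q00 q01 q02 q11 q12 q22 vP); ring.
Qed.

(** The offset (- sg p, - sg q, sg) is normal to the graph, so the terms in w cancel: moving the
    foot point affects the squared distance to second order only. *)
Lemma gap_slope_normal (p q w0 w1 sg v0 v1 v2 : R) :
  gap_slope p q w0 w1 (- sg * p) (- sg * q) sg v0 v1 v2
  = 2 * (- sg * p * v0 + - sg * q * v1 + sg * v2).
Proof. by rewrite /gap_slope; ring. Qed.

Lemma sqr_slope_sum (X0 X1 X2 : R) (v : 'I_3 -> 'I_3 -> R) : orthonormal3 v ->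
  (2 * (X0 * v 0 0 + X1 * v 0 1 + X2 * v 0 ord_max)) ^+ 2
  + (2 * (X0 * v 1 0 + X1 * v 1 1 + X2 * v 1 ord_max)) ^+ 2
  + (2 * (X0 * v ord_max 0 + X1 * v ord_max 1 + X2 * v ord_max ord_max)) ^+ 2
  = 4 * (X0 ^+ 2 + X1 ^+ 2 + X2 ^+ 2).
Proof.
move=> vP; have /= := orthonormal3_sum (4 * X0 ^+ 2) (8 * X0 * X1) (8 * X0 * X2)
  (4 * X1 ^+ 2) (8 * X1 * X2) (4 * X2 ^+ 2) vP.
by rewrite -!mulrDr => <-; ring.
Qed.

End BarrierAlgebra.

(** * Trace and determinant from the principal curvatures *)

Section Shape.
Context {R : realType}.

(** Here [al], [be], [ga], [ep] are the entries of the shape operator S, and the four equations are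
    the entries of G S = s^-1 Hess. They express the Hessian through S without inverting G. *)
Lemma shape_entries (p q a m m' d s al be ga ep k : R) :
  m = m' -> 0 < s -> s ^+ 2 = 1 + p ^+ 2 + q ^+ 2 ->
  (1 + p * p) * al + p * q * ga = s^-1 * a ->
  (1 + p * p) * be + p * q * ep = s^-1 * m ->
  q * p * al + (1 + q * q) * ga = s^-1 * m' ->
  q * p * be + (1 + q * q) * ep = s^-1 * d ->
  al + ep = 0 -> al * ep - be * ga = - k ^+ 2 ->
  forall sg, shape_trace p q a m d sg = 0 /\
    shape_det p q a m d sg = - (k ^+ 2 * (sg ^+ 2 * (1 + p ^+ 2 + q ^+ 2))).
Proof.
move=> <- s0 sE E1 E2 E3 E4 tr0 det sg.
have sn : s != 0 by rewrite gt_eqF.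
have {}E1 : a = s * ((1 + p * p) * al + p * q * ga) by rewrite E1; field.
have {}E4 : d = s * (q * p * be + (1 + q * q) * ep) by rewrite E4; field.
have {}E2 : m = s * ((1 + p * p) * be + p * q * ep) by rewrite E2; field.
have {}E3 : m = s * (q * p * al + (1 + q * q) * ga) by rewrite E3; field.
rewrite /shape_trace /shape_det -sE; split.
  have -> : (1 + q ^+ 2) * a - 2 * p * q * m + (1 + p ^+ 2) * d
     = s * (1 + p ^+ 2 + q ^+ 2) * (al + ep).
    (* The equations give two expressions for [m], from the entries (0,1) and (1,0). One copy of [m]
       is replaced by each, after which the identity is polynomial. *)
    have -> : 2 * p * q * m = p * q * m + p * q * m by ring.
    by rewrite {1}E2 E3 E1 E4; ring.
  by rewrite tr0 !mulr0 mul0r.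
have -> : a * d - m ^+ 2 = s ^+ 2 * (1 + p ^+ 2 + q ^+ 2) * (al * ep - be * ga).
  by rewrite expr2 {1}E2 E3 E1 E4; ring.
by rewrite det -sE; field.
Qed.

Lemma ord2P (j : 'I_2) : j = 0 \/ j = 1.
Proof. by case: j => [[|[|//]] jP]; [left|right]; exact: val_inj. Qed.

Lemma sum_ord2 (F : 'I_2 -> R) : \sum_i F i = F 0 + F 1.
Proof.
by rewrite !big_ord_recr big_ord0 /= add0r; congr (F _ + F _); exact: val_inj.
Qed.

Lemma det_mx22 (A : 'M[R]_2) : \det A = A 0 0 * A 1 1 - A 0 1 * A 1 0.
Proof.
have l0 : lift (0 : 'I_2) 0 = 1 by exact: val_inj.
have l1 : lift (1 : 'I_2) 0 = 0 by exact: val_inj.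
rewrite (expand_det_row A 0) sum_ord2 /cofactor !det_mx11 !mxE /= l0 l1.
by rewrite !expr1 !expr0; ring.
Qed.

Lemma char_poly_mx22 (A : 'M[R]_2) (k1 k2 : R) :
  char_poly A = ('X - k1%:P) * ('X - k2%:P) ->
  A 0 0 + A 1 1 = k1 + k2 /\ A 0 0 * A 1 1 - A 0 1 * A 1 0 = k1 * k2.
Proof.
move=> E; split.
  rewrite -(sum_ord2 (fun i => A i i)) -/(mxtrace A) -[LHS]opprK -char_poly_trace //.
  rewrite E mulrBl coefB coefXM coefCM !coefB !coefC !coefX /=; ring.
rewrite -det_mx22.
have := char_poly_det A; rewrite expr2 mulrNN !mul1r => <-.
by rewrite E mulrBl coefB coefXM coefCM !coefB !coefC !coefX /=; ring.
Qed.

Lemma one_plus_sqr2_gt0 (p q : R) : 0 < 1 + p ^+ 2 + q ^+ 2.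
Proof. by rewrite -addrA ltr_pwDl // addr_ge0 // sqr_ge0. Qed.

(** The factor sg^2 (1 + p^2 + q^2) is going to be d^2, so this records that the eigenvalues of K
    are k1 d and - k1 d. *)
Lemma shape_operator_invariants (phi : 'rV[R]_2 -> R) t k1 k2 : of_class_C 2 phi ->
  char_poly (shape_operator phi t) = ('X - k1%:P) * ('X - k2%:P) -> k1 + k2 = 0 ->
  forall sg,
  let p := partial 0 phi t in let q := partial 1 phi t in
  let a := partials [:: 0; 0] phi t in let m := partials [:: 0; 1] phi t in
  let d := partials [:: 1; 1] phi t in
  shape_trace p q a m d sg = 0 /\
  shape_det p q a m d sg = - (k1 ^+ 2 * (sg ^+ 2 * (1 + p ^+ 2 + q ^+ 2))).
Proof.
move=> C2 cP kk sg p q a m d.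
have kk' : k1 * k2 = - k1 ^+ 2.
  by move/eqP: kk; rewrite addrC addr_eq0 => /eqP ->; rewrite mulrN.
have [trS detS] := char_poly_mx22 cP; rewrite kk in trS; rewrite kk' in detS.
set S := shape_operator phi t in cP trS detS.
set s := Num.sqrt (1 + enorm (gradient phi t) ^+ 2).
have gE : enorm (gradient phi t) ^+ 2 = p ^+ 2 + q ^+ 2.
  by rewrite sqr_enorm sum_ord2 !mxE.
have D0 := one_plus_sqr2_gt0 p q.
have s0 : 0 < s by rewrite sqrtr_gt0 gE addrA.
have sE : s ^+ 2 = 1 + p ^+ 2 + q ^+ 2.
  by rewrite sqr_sqrtr gE addrA // ltW.
have G i j : first_form phi t i j = (i == j)%:R + partial i phi t * partial j phi t.
  by rewrite !mxE big_ord1 !mxE.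
have Gu : first_form phi t \in unitmx.
  rewrite unitmxE unitfE det_mx22 !G !eqxx /= -/p -/q.
  suff -> : (1 + p * p) * (1 + q * q) - (0 + p * q) * (0 + q * p) = 1 + p ^+ 2 + q ^+ 2.
    by rewrite gt_eqF.
  by ring.
have GS : first_form phi t *m S = s^-1 *: hessian phi t.
  by rewrite /S /shape_operator mulKVmx.
have GSij i j : first_form phi t i 0 * S 0 j + first_form phi t i 1 * S 1 j
    = s^-1 * partials [:: i; j] phi t.
  rewrite -(sum_ord2 (fun k => first_form phi t i k * S k j)).
  by have := congr1 (fun M : 'M[R]_2 => M i j) GS; rewrite !mxE.
have E1 := GSij 0 0; have E2 := GSij 0 1; have E3 := GSij 1 0; have E4 := GSij 1 1.
rewrite !G !eqxx /= !add0r in E1 E2 E3 E4.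
exact: (shape_entries (partials_sym t 0 1 C2) s0 sE E1 E2 E3 E4 trS detS).
Qed.

End Shape.

(** * Upper barrier for the squared distance at an interior point *)

Section ChartBarrier.
Context {R : realType}.
Variables (Omega : set 'rV[R]_3) (x y : 'rV[R]_3).
Hypotheses (Omega_open : open Omega) (Ox : Omega x) (Oy : ~ Omega y)
  (xy : enorm (x - y) = dist_compl Omega x).
Variables (Q : 'M[R]_3) (phi : 'rV[R]_2 -> R).
Hypothesis chart : boundary_chart Omega y Q phi.

Let t := col' ord_max (y *m Q).
Let X := (x - y) *m Q.

Let QQ : Q *m Q^T = 1%:M. Proof. by case: chart => [[]]. Qed.
Let C2 : of_class_C 2 phi. Proof. by case: chart. Qed.

Let Omega_nT : ~` Omega !=set0. Proof. by exists y. Qed.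

Definition graph_point (u : 'rV[R]_2) : 'rV[R]_3 :=
  \row_j [:: u 0 0; u 0 1; phi u]`_j.

Lemma lift_max0 : lift ord_max (0 : 'I_2) = 0 :> 'I_3.
Proof. exact: val_inj. Qed.

Lemma lift_max1 : lift ord_max (1 : 'I_2) = 1 :> 'I_3.
Proof. exact: val_inj. Qed.

Lemma col'_graph_point u : col' ord_max (graph_point u) = u.
Proof.
by apply/rowP => j; rewrite !mxE; have [->|->] := ord2P j; rewrite ?lift_max0 ?lift_max1.
Qed.

(** As y is outside Omega, it is not above the graph; points of the segment towards x are in Omega,
    hence above it, and letting them tend to y gives the other inequality. *)
Lemma boundary_on_graph : phi t = (y *m Q) 0 ord_max.
Proof.
case: (chart) => _ _ [r r0 rP]; apply/eqP; rewrite eq_le; apply/andP; split; last first.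
  by rewrite leNgt; apply/negP => /(rP y); rewrite subrr enorm0 => /(_ r0).
pose w := col' ord_max X.
have L := expands_cvg (expandsD (expands_graph t w C2) (expands_affine 0 (- X 0 ord_max))).
rewrite addr0 in L.
have d0 := dist_compl_gt0 Omega_open Omega_nT Ox.
apply: (cvgr_to_le (cvg_dnbhs_at_right L)); near=> h.
have h0 : 0 < h by near: h; exact: nbhs_right_gt.
have h1 : h < 1 by near: h; exact: nbhs_right_lt.
have hr : h < r / dist_compl Omega x by near: h; apply: nbhs_right_lt; exact: (divr_gt0 r0 d0).
have zO : Omega (y + h *: (x - y)).
  apply: contrapT => /(dist_compl_le x); apply/negP; rewrite -ltNge.
  rewrite opprD addrA -{1}[x - y]scale1r -scalerBl enormZ xy.
  by rewrite gtr0_norm ?subr_gt0 // -[ltRHS]mul1r ltr_pM2r // gtrBl.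
have zr : enorm (y + h *: (x - y) - y) < r.
  by rewrite addrC addKr enormZ xy gtr0_norm // -ltr_pdivlMr.
have := (rP _ zr).1 zO; rewrite mulmxDl -scalemxAl -/X.
have -> : col' ord_max (y *m Q + h *: X) = t + h *: w by apply/rowP => j; rewrite !mxE.
rewrite ![((y *m Q + _) : 'rV_3) 0 ord_max]mxE [(h *: X) _ _]mxE => lt.
by rewrite add0r mulNr lerBlDr [X 0 _ * _]mulrC ltW.
Unshelve. all: by end_near. Qed.

(** The base point is left general: z = x yields the barrier, and z = y with v = 0 yields the
    distance from y to nearby graph points, which must stay within the radius of the chart. *)
Lemma graph_gap_dist z w v h :
  enorm ((z + h *: v - graph_point (t + h *: w) *m Q^T) *m Q) ^+ 2 =
  graph_gap phi t w ((z - y) *m Q) (v *m Q) h.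
Proof.
set Z := (z - y) *m Q.
rewrite mulmxBl -mulmxA (mulmx1C QQ) mulmx1 mulmxDl -scalemxAl.
have XE j : (z *m Q) 0 j = Z 0 j + (y *m Q) 0 j.
  by rewrite /Z mulmxBl [in RHS]mxE [X in _ + X + _]mxE subrK.
have t0 : t 0 0 = (y *m Q) 0 0 by rewrite /t [LHS]mxE lift_max0.
have t1 : t 0 1 = (y *m Q) 0 1 by rewrite /t [LHS]mxE lift_max1.
have E j : (z *m Q + h *: (v *m Q) - graph_point (t + h *: w)) 0 j =
    Z 0 j + (y *m Q) 0 j + h * (v *m Q) 0 j - graph_point (t + h *: w) 0 j.
  by rewrite -XE [LHS]mxE [X in X + _]mxE [X in _ + X + _]mxE [X in _ + X = _]mxE.
rewrite sqr_enorm3 !E /graph_gap boundary_on_graph -t0 -t1.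
have -> : graph_point (t + h *: w) 0 0 = t 0 0 + h * w 0 0 by rewrite !mxE.
have -> : graph_point (t + h *: w) 0 1 = t 0 1 + h * w 0 1 by rewrite !mxE.
have -> : graph_point (t + h *: w) 0 ord_max = phi (t + h *: w) by rewrite mxE.
ring.
Qed.

Lemma graph_point_notin w : \forall h \near (0 : R)^',
  ~ Omega (graph_point (t + h *: w) *m Q^T).
Proof.
case: (chart) => _ _ [r r0 rP].
pose G h := enorm ((y + h *: 0 - graph_point (t + h *: w) *m Q^T) *m Q) ^+ 2.
have L := expands_cvg (expands_gap t w ((y - y) *m Q) (0 *m Q) C2).
rewrite {2}subrr {2}mul0mx enorm0 expr0n /= in L.
have H : \forall h \near (0 : R)^', G h < r ^+ 2.
  rewrite /G; under eq_near do rewrite graph_gap_dist.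
  by apply: (cvgr_lt _ L); rewrite exprn_gt0.
near=> h => Oz.
have zr : enorm (graph_point (t + h *: w) *m Q^T - y) < r.
  rewrite -[_ - y]opprB enormN -(@ltr_pXn2r _ 2) ?nnegrE ?enorm_ge0 ?ltW //.
  have -> : y - graph_point (t + h *: w) *m Q^T
      = y + h *: 0 - graph_point (t + h *: w) *m Q^T by rewrite scaler0 addr0.
  by rewrite -(enorm_rotation _ QQ) -/(G h); near: h.
have := (rP _ zr).1 Oz; rewrite -mulmxA (mulmx1C QQ) mulmx1 col'_graph_point.
by rewrite [ltRHS]mxE ltxx.
Unshelve. all: by end_near. Qed.

Lemma dist_compl_graph_gap w v : \forall h \near (0 : R)^',
  dist_compl Omega (x + h *: v) ^+ 2 <= graph_gap phi t w X (v *m Q) h.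
Proof.
apply: filterS (graph_point_notin w) => h Oz.
rewrite -graph_gap_dist (enorm_rotation _ QQ).
by rewrite ler_pXn2r ?nnegrE ?enorm_ge0 ?dist_compl_ge0 ?dist_compl_le.
Qed.

(** With x fixed, that is v = 0, moving the foot point along the graph cannot bring it closer to x,
    so the slope vanishes for every w; two choices of w determine X. *)
Lemma normal_coords : let p := partial 0 phi t in let q := partial 1 phi t in
  X 0 0 = - X 0 ord_max * p /\ X 0 1 = - X 0 ord_max * q.
Proof.
move=> p q.
have slope0 (w : 'rV[R]_2) : gap_slope p q (w 0 0) (w 0 1) (X 0 0) (X 0 1) (X 0 ord_max) 0 0 0 = 0.
  have z j : (0 : 'rV[R]_3) 0 j = 0 by rewrite mxE.
  have E := expands_gap t w X 0 C2; rewrite !z in E.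
  apply: (expands_min E).
  have := dist_compl_graph_gap w 0; rewrite mul0mx; apply: filterS => h; apply: le_trans.
  by rewrite scaler0 addr0 -xy (enorm_rotation _ QQ).
have solve w0 w1 X0 X1 X2 : gap_slope p q w0 w1 X0 X1 X2 0 0 0 =
    - 2 * (w0 * (X0 + X2 * p) + w1 * (X1 + X2 * q)) by rewrite /gap_slope; ring.
have := slope0 (\row_j (j == 0)%:R); have := slope0 (\row_j (j == 1)%:R).
rewrite !mxE !eqxx /= !solve !mul0r !mul1r add0r addr0.
move=> /eqP; rewrite mulf_eq0 oppr_eq0 pnatr_eq0 /= addr_eq0 => /eqP ->.
move=> /eqP; rewrite mulf_eq0 oppr_eq0 pnatr_eq0 /= addr_eq0 => /eqP ->.
by rewrite !mulNr.
Qed.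

(** The [b i] are the components of a gradient of length 2 d. The [c i] are halves of second
    derivatives, so their sum is half of the Laplacian of the barrier at x. *)
Lemma dist_compl_barrier k1 k2 :
  char_poly (shape_operator phi t) = ('X - k1%:P) * ('X - k2%:P) -> k1 + k2 = 0 ->
  exists (F : 'I_3 -> R -> R) (b c : 'I_3 -> R),
  [/\ forall i, expands (F i) (dist_compl Omega x ^+ 2) (b i) (c i),
      forall i, \forall h \near (0 : R)^',
        dist_compl Omega (x + h *: delta_mx 0 i) ^+ 2 <= F i h,
      \sum_i b i ^+ 2 = 4 * dist_compl Omega x ^+ 2
    & \sum_i c i = 1 - 2 * k1 ^+ 2 * dist_compl Omega x ^+ 2].
Proof.
move=> cP kk.
have [X0 X1] := normal_coords.
set p := partial 0 phi t in X0 X1; set q := partial 1 phi t in X0 X1.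
set a := partials [:: 0; 0] phi t; set m := partials [:: 0; 1] phi t.
set d := partials [:: 1; 1] phi t; set sg := X 0 ord_max in X0 X1.
have [tr0 detE] := shape_operator_invariants C2 cP kk sg.
rewrite -/p -/q -/a -/m -/d in tr0 detE.
have dE : dist_compl Omega x ^+ 2 = sg ^+ 2 * (1 + p ^+ 2 + q ^+ 2).
  by rewrite -xy -(enorm_rotation _ QQ) sqr_enorm3 -/X X0 X1 -/sg; ring.
pose v i : 'rV[R]_3 := delta_mx 0 i *m Q.
have vE i j : v i 0 j = Q i j by rewrite /v -rowE mxE.
have vP : orthonormal3 (fun i j => v i 0 j).
  move=> j k; rewrite !vE.
  have := congr1 (fun M : 'M[R]_3 => M j k) (mulmx1C QQ).
  by rewrite [X in X = _]mxE sum_ord3 [X in _ = X]mxE ![Q^T _ _]mxE.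
pose w i : 'rV[R]_2 := \row_j
  [:: foot0 p q a m d sg (v i 0 0) (v i 0 1) (v i 0 ord_max);
      foot1 p q a m d sg (v i 0 0) (v i 0 1) (v i 0 ord_max)]`_j.
have w0 i : w i 0 0 = foot0 p q a m d sg (v i 0 0) (v i 0 1) (v i 0 ord_max).
  by rewrite mxE.
have w1 i : w i 0 1 = foot1 p q a m d sg (v i 0 0) (v i 0 1) (v i 0 ord_max).
  by rewrite mxE.
exists (fun i => graph_gap phi t (w i) X (v i)).
exists (fun i => 2 * (X 0 0 * v i 0 0 + X 0 1 * v i 0 1 + sg * v i 0 ord_max)).
exists (fun i => foot_curv p q a m d sg (v i 0 0) (v i 0 1) (v i 0 ord_max)).
split.
- move=> i; apply: expands_coef (expands_gap t (w i) X (v i) C2) _ _ _.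
  + by rewrite -xy (enorm_rotation _ QQ).
  + rewrite -/p -/q -/sg X0 X1; exact: gap_slope_normal.
  + by rewrite /foot_curv -w0 -w1.
- by move=> i; exact: dist_compl_graph_gap.
- rewrite sum_ord3 (sqr_slope_sum (X 0 0) (X 0 1) sg vP) dE X0 X1; ring.
- by rewrite sum_ord3 (foot_curv_sum vP tr0) detE dE; ring.
Qed.

End ChartBarrier.

(** * Second differences of the square root of the distance *)

Section SecondDifference.
Context {R : realType}.

(** The barrier bounds d^2, of which u = sqrt d is the fourth root. *)
Lemma expands_root4 (F : R -> R) (D b c : R) : 0 < D -> expands F (D ^+ 2) b c ->
  expands (fun h => Num.sqrt (Num.sqrt (F h))) (Num.sqrt D) (b / (4 * D * Num.sqrt D))
    ((8 * D ^+ 2 * c - 3 * b ^+ 2) / (32 * D ^+ 3 * Num.sqrt D)).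
Proof.
move=> D0 FE.
have s0 : Num.sqrt D != 0 by rewrite gt_eqF // sqrtr_gt0.
have sE : Num.sqrt D ^+ 2 = D by rewrite sqr_sqrtr // ltW.
have := expands_sqrt (exprn_gt0 2 D0) FE.
rewrite sqrtr_sqr (gtr0_norm D0) => E; have {}E := expands_sqrt D0 E.
apply: expands_coef E _ _ _ => //.
  by field; rewrite s0 gt_eqF.
move: s0 sE D0; set r := Num.sqrt D => r0 <- D0; field.
by rewrite r0.
Qed.

(** With u = sqrt d, this is minus the symmetric second difference of u in direction i, divided by
    u(x): the discrete form of - (d_i d_i u) / u. *)
Definition second_diff (Omega : set 'rV[R]_3) (x : 'rV[R]_3) (h : R) (i : 'I_3) : R :=
  (2 - (Num.sqrt (dist_compl Omega (x + h *: delta_mx 0 i))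
     + Num.sqrt (dist_compl Omega (x - h *: delta_mx 0 i)))
    / Num.sqrt (dist_compl Omega x)) / h ^+ 2.

Lemma near0N (P : R -> Prop) : (\forall h \near (0 : R)^', P h) ->
  \forall h \near (0 : R)^', P (- h).
Proof.
suff H : (0 : R)^' P -> (0 : R)^' (fun h => P (- h)) by exact: H.
rewrite -[in X in X -> _]oppr0 dnbhsN => -[B HB <-].
by apply: filterS HB => h Bh; exists h.
Qed.

(** The linear terms cancel in pairs, and the constraints on the b's and c's make twice the sum of
    the three [C] equal to - (1 / (4 D^2) + k^2) r. The margin [eta] absorbs the remainder e < eta
    r. *)
Lemma second_diff_arith (D r k eta h e b0 b1 b2 c0 c1 c2 S0 S1 S2 S3 S4 S5
    u0 u1 u2 u3 u4 u5 : R) :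
  0 < r -> r ^+ 2 = D -> h != 0 -> e < eta * r ->
  b0 ^+ 2 + b1 ^+ 2 + b2 ^+ 2 = 4 * D ^+ 2 -> c0 + c1 + c2 = 1 - 2 * k ^+ 2 * D ^+ 2 ->
  u0 <= S0 -> u1 <= S1 -> u2 <= S2 -> u3 <= S3 -> u4 <= S4 -> u5 <= S5 ->
  let B b := b / (4 * D * r) in
  let C b c := (8 * D ^+ 2 * c - 3 * b ^+ 2) / (32 * D ^+ 3 * r) in
  S0 + S1 + (S2 + S3) + (S4 + S5) = r + r + (r + r) + (r + r)
    + (B b0 - B b0 + (B b1 - B b1) + (B b2 - B b2)) * h
    + (C b0 c0 + C b0 c0 + (C b1 c1 + C b1 c1) + (C b2 c2 + C b2 c2) + e) * h ^+ 2 ->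
  (4 * D ^+ 2)^-1 + k ^+ 2 - eta <= (2 - (u0 + u1) / r) / h ^+ 2
    + (2 - (u2 + u3) / r) / h ^+ 2 + (2 - (u4 + u5) / r) / h ^+ 2.
Proof.
move=> r0 rE h0 eh sb sc L0 L1 L2 L3 L4 L5 B C SE.
have H0 : 0 < h ^+ 2 by rewrite exprn_even_gt0.
have -> : (2 - (u0 + u1) / r) / h ^+ 2 + (2 - (u2 + u3) / r) / h ^+ 2
    + (2 - (u4 + u5) / r) / h ^+ 2
    = (6 - (u0 + u1 + (u2 + u3) + (u4 + u5)) / r) / h ^+ 2.
  by field; rewrite h0 gt_eqF.
rewrite ler_pdivlMr // lerBrDr -lerBrDl ler_pdivrMr //.
have {L0 L1 L2 L3 L4 L5} : u0 + u1 + (u2 + u3) + (u4 + u5)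
    <= S0 + S1 + (S2 + S3) + (S4 + S5) by rewrite !lerD.
rewrite {}SE /B /C => L; apply: (le_trans L).
have c0E : c0 = 1 - 2 * k ^+ 2 * D ^+ 2 - c1 - c2 by rewrite -sc; ring.
have b0E : b0 ^+ 2 = 4 * D ^+ 2 - b1 ^+ 2 - b2 ^+ 2 by rewrite -sb; ring.
rewrite -subr_ge0; set K := _ - _.
have -> : K = (eta * r - e) * h ^+ 2.
  by rewrite /K b0E c0E -rE; field; rewrite gt_eqF.
by rewrite mulr_ge0 ?ltW // subr_gt0.
Qed.

Lemma second_diff_lower (Omega : set 'rV[R]_3) x y Q phi k1 k2 (eta : R) :
  open Omega -> Omega x -> ~ Omega y -> enorm (x - y) = dist_compl Omega x ->
  boundary_chart Omega y Q phi ->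
  char_poly (shape_operator phi (col' ord_max (y *m Q))) =
    ('X - k1%:P) * ('X - k2%:P) -> k1 + k2 = 0 -> 0 < eta ->
  \forall h \near (0 : R)^',
    (4 * dist_compl Omega x ^+ 2)^-1 + k1 ^+ 2 - eta
    <= \sum_i second_diff Omega x h i.
Proof.
move=> Oo Ox Oy xy chart cP kk eta0.
have [F [b [c [FE Fle sb sc]]]] := dist_compl_barrier Oo Ox Oy xy chart cP kk.
have Onc : ~` Omega !=set0 by exists y.
have D0 := dist_compl_gt0 Oo Onc Ox.
set D := dist_compl Omega x in FE D0 sb sc *.
(* Adding the expansion at - h removes the term of first order. *)
have GE i := expandsD (expands_root4 D0 (FE i)) (expandsN_arg (expands_root4 D0 (FE i))).
have := expandsD (expandsD (GE 0) (GE 1)) (GE ord_max).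
set r := Num.sqrt D; rewrite /= => -[e e0 SE].
have r0 : 0 < r by rewrite sqrtr_gt0.
have rE : r ^+ 2 = D by rewrite sqr_sqrtr // ltW.
have le i : \forall h \near (0 : R)^',
   Num.sqrt (dist_compl Omega (x + h *: delta_mx 0 i))
   <= Num.sqrt (Num.sqrt (F i h)).
  apply: filterS (Fle i) => h le; rewrite ler_wsqrtr //.
  rewrite -[leLHS]ger0_norm ?dist_compl_ge0 // -sqrtr_sqr ler_wsqrtr //.
have le' i : \forall h \near (0 : R)^',
   Num.sqrt (dist_compl Omega (x - h *: delta_mx 0 i))
   <= Num.sqrt (Num.sqrt (F i (- h))).
  by apply: filterS (near0N (le i)) => h; rewrite scaleNr.
near=> h.
have h0 : h != 0 by near: h; exact: nbhs_dnbhs_neq.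
have eh : e h < eta * r.
  by near: h; apply: (cvgr_lt _ e0); rewrite mulr_gt0.
have L0 : Num.sqrt (dist_compl Omega (x + h *: delta_mx 0 0)) <= Num.sqrt (Num.sqrt (F 0 h)).
  by near: h; exact: le.
have L1 : Num.sqrt (dist_compl Omega (x + h *: delta_mx 0 1)) <= Num.sqrt (Num.sqrt (F 1 h)).
  by near: h; exact: le.
have L2 : Num.sqrt (dist_compl Omega (x + h *: delta_mx 0 ord_max))
    <= Num.sqrt (Num.sqrt (F ord_max h)).
  by near: h; exact: le.
have M0 : Num.sqrt (dist_compl Omega (x - h *: delta_mx 0 0)) <= Num.sqrt (Num.sqrt (F 0 (- h))).
  by near: h; exact: le'.
have M1 : Num.sqrt (dist_compl Omega (x - h *: delta_mx 0 1)) <= Num.sqrt (Num.sqrt (F 1 (- h))).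
  by near: h; exact: le'.
have M2 : Num.sqrt (dist_compl Omega (x - h *: delta_mx 0 ord_max))
    <= Num.sqrt (Num.sqrt (F ord_max (- h))).
  by near: h; exact: le'.
have {}SE := SE h.
rewrite sum_ord3 /second_diff -/D -/r.
rewrite sum_ord3 in sb; rewrite sum_ord3 in sc.
exact: (second_diff_arith r0 rE h0 eh sb sc L0 M0 L1 M1 L2 M2 SE).
Unshelve. all: by end_near. Qed.

End SecondDifference.

(** * Pointwise bounds for a minimal boundary *)

Section MinimalBoundary.
Context {R : realType}.
Variable Omega : set 'rV[R]_3.
Hypotheses (Omega_open : open Omega) (boundary_nonempty : boundary Omega !=set0).
Hypothesis Omega_minimal : minimal_boundary Omega.

Lemma compl_nonempty : ~` Omega !=set0.
Proof.
have [y [_ yi]] := boundary_nonempty.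
by exists y => Oy; apply: yi; exact: (Omega_open Oy).
Qed.

Lemma kappa0_ge0 : 0 <= kappa0 Omega.
Proof.
have [y yb] := boundary_nonempty.
have [k1 [k2 [kP _]]] := Omega_minimal yb.
apply: lb_le_inf; first by exists `|k1|, y, k1, k2.
by move=> _ [_ [k [_ [_ _ ->]]]].
Qed.

Lemma kappa0_le y k1 k2 : boundary Omega y -> principal_curvatures Omega y k1 k2 ->
  kappa0 Omega ^+ 2 <= k1 ^+ 2.
Proof.
move=> yb kP; rewrite -[leRHS]real_normK ?num_real //.
rewrite ler_pXn2r ?nnegrE ?kappa0_ge0 //.
apply: ge_inf; last by exists y, k1, k2.
by exists 0 => _ [_ [k [_ [_ _ ->]]]].
Qed.

Lemma second_diff_liminf x (eta : R) : Omega x -> 0 < eta ->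
  \forall h \near (0 : R)^',
    (4 * dist_compl Omega x ^+ 2)^-1 + kappa0 Omega ^+ 2 - eta
    <= \sum_i second_diff Omega x h i.
Proof.
move=> Ox eta0.
have [y Oy xy] := dist_compl_attained Omega_open compl_nonempty x.
have yb := nearest_in_boundary Omega_open compl_nonempty Ox Oy xy.
have [k1 [k2 [kP /esym kk]]] := Omega_minimal yb.
have k0 := kappa0_le yb kP.
have [Q [phi [chart cP]]] := kP.
have := second_diff_lower Omega_open Ox Oy xy chart cP kk eta0.
by apply: filterS => h; apply: le_trans; rewrite lerD2r lerD2l.
Qed.

(** The graph of u^4 lies above its tangent at r. With u^4 = d(x + s e_i)^2, r^4 = d(x)^2 and a
    fixed nearest point, the terms odd in s cancel between s = h and s = - h, and 2 h^2 / (4 r^4) is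
    the source of the bound 1 / (2 d^2), valid for every nonzero step. *)
Lemma tangent4 (u r s : R) : 0 <= u -> 0 < r -> u ^+ 4 <= r ^+ 4 + s ->
  4 * r ^+ 3 * (u - r) <= s.
Proof.
move=> u0 r0 us.
have -> : 4 * r ^+ 3 * (u - r)
    = u ^+ 4 - r ^+ 4 - (u - r) ^+ 2 * (u ^+ 2 + 2 * u * r + 3 * r ^+ 2) by ring.
have : 0 <= (u - r) ^+ 2 * (u ^+ 2 + 2 * u * r + 3 * r ^+ 2).
  by rewrite mulr_ge0 ?sqr_ge0 // !addr_ge0 ?mulr_ge0 ?sqr_ge0 // ltW.
lra.
Qed.

(* Concavity of the fourth root along the segment through the nearest point. *)
Lemma second_diff_ge x h i : Omega x -> h != 0 ->
  - (2 * dist_compl Omega x ^+ 2)^-1 <= second_diff Omega x h i.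
Proof.
move=> Ox h0.
have [y Oy xy] := dist_compl_attained Omega_open compl_nonempty x.
have D0 := dist_compl_gt0 Omega_open compl_nonempty Ox.
have key (s : R) : Num.sqrt (dist_compl Omega (x + s *: delta_mx 0 i)) ^+ 4
    <= Num.sqrt (dist_compl Omega x) ^+ 4 + (2 * s * (x - y) 0 i + s ^+ 2).
  rewrite !(exprM _ 2 2) !sqr_sqrtr ?dist_compl_ge0 //; try exact: compl_nonempty.
  apply: (@le_trans _ _ (enorm (x + s *: delta_mx 0 i - y) ^+ 2)).
    rewrite ler_pXn2r ?nnegrE ?enorm_ge0 ?dist_compl_ge0 ?dist_compl_le //.
    exact: compl_nonempty.
  rewrite -xy !sqr_enorm.
  rewrite (bigD1 i) //= [in leRHS](bigD1 i) //= !mxE !eqxx /= mulr1.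
  rewrite (eq_bigr (fun j => (x - y) 0 j ^+ 2)); last first.
    by move=> j /negPf ji; rewrite !mxE ji andbF mulr0 addr0.
  by rewrite le_eqVlt; apply/orP; left; apply/eqP; ring.
rewrite /second_diff.
have := key h; have := key (- h); rewrite scaleNr.
move: (x - y) => z.
have r0 : 0 < Num.sqrt (dist_compl Omega x) by rewrite sqrtr_gt0.
have rE : Num.sqrt (dist_compl Omega x) ^+ 2 = dist_compl Omega x.
  by rewrite sqr_sqrtr // ltW.
rewrite -[X in - (2 * X ^+ 2)^-1]rE {rE}; move: (Num.sqrt (dist_compl Omega x)) r0 => r r0 K1 K2.
have T1 := tangent4 (sqrtr_ge0 _) r0 K1.
have T2 := tangent4 (sqrtr_ge0 _) r0 K2.
have H0 : 0 < h ^+ 2 by rewrite exprn_even_gt0.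
rewrite ler_pdivlMr // -subr_ge0.
set u1 := Num.sqrt _ in T2 *; set u2 := Num.sqrt _ in T1 *.
have -> : 2 - (u1 + u2) / r - - (2 * (r ^+ 2) ^+ 2)^-1 * h ^+ 2
   = (2 * h ^+ 2 - (4 * r ^+ 3 * (u1 - r) + 4 * r ^+ 3 * (u2 - r))) / (4 * r ^+ 4).
  by field; rewrite gt_eqF.
rewrite divr_ge0 ?mulr_ge0 ?exprn_ge0 ?(ltW r0) //; lra.
Qed.

End MinimalBoundary.

(** * Translation invariance of Lebesgue measure *)

Section MeasurePreserving.
Context {R : realType}.

Definition measure_preserving d (T : measurableType d) (m : set T -> \bar R)
    (phi : T -> T) : Prop :=
  measurable_fun setT phi /\ forall A, measurable A -> m (phi @^-1` A) = m A.

(** Uniqueness of the product measure reduces the claim to rectangles. *)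
Lemma measure_preserving_prod d1 d2 (T1 : measurableType d1) (T2 : measurableType d2)
    (m1 : {sigma_finite_measure set T1 -> \bar R})
    (m2 : {sigma_finite_measure set T2 -> \bar R}) (f1 : T1 -> T1) (f2 : T2 -> T2) :
  measure_preserving m1 f1 -> measure_preserving m2 f2 ->
  measure_preserving (m1 \x m2)%E (fun p : T1 * T2 => (f1 p.1, f2 p.2)).
Proof.
move=> [mf1 m1E] [mf2 m2E].
have mf : measurable_fun setT (fun p : T1 * T2 => (f1 p.1, f2 p.2)).
  apply/measurable_fun_pairP; split.
  - exact: (@measurableT_comp _ _ _ _ _ _ f1 _ fst).
  - exact: (@measurableT_comp _ _ _ _ _ _ f2 _ snd).
split=> // A mA; pose F (p : T1 * T2) := (f1 p.1, f2 p.2).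
apply/esym/(@product_measure_unique _ _ _ _ _ m1 m2
  (pushforward (m1 \x m2)%E F)) => // B C mB mC.
have mB' : measurable (f1 @^-1` B) by rewrite -[X in measurable X]setTI; exact: mf1.
have mC' : measurable (f2 @^-1` C) by rewrite -[X in measurable X]setTI; exact: mf2.
transitivity ((m1 \x m2)%E ((f1 @^-1` B) `*` (f2 @^-1` C))); first by [].
by rewrite -(m1E B mB) -(m2E C mC); exact: product_measure1E.
Qed.

Lemma ge0_integral_measure_preserving d (T : measurableType d)
    (m : {measure set T -> \bar R}) (phi : T -> T) (g : T -> \bar R) :
  measure_preserving m phi -> measurable_fun setT g -> (forall x, 0 <= g x)%E ->
  (\int[m]_x g (phi x) = \int[m]_x g x)%E.
Proof.
move=> [mphi mE] mg g0.
have := ge0_integral_pushforward mphi m measurableT mg (fun x _ => g0 x).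
rewrite preimage_setT /= => <-.
by apply: eq_measure_integral => A mA _; rewrite /= -mE.
Qed.

Lemma measure_preserving_shift (a : R) :
  measure_preserving (@lebesgue_measure R)
    ((fun x => x + a) : measurableTypeR R -> measurableTypeR R).
Proof.
have mf : measurable_fun setT ((fun x => x + a) : measurableTypeR R -> measurableTypeR R).
  exact: measurable_funD.
split=> // A mA.
apply/esym/(@lebesgue_measure_unique _ (pushforward lebesgue_measure
  ((fun x => x + a) : measurableTypeR R -> measurableTypeR R))) => // _ [[b c] _ <-].
rewrite /= /pushforward.
have -> : (fun x => x + a) @^-1` `]b, c] = `]b - a, c - a]%classic.
  by apply/seteqP; split=> x /=; rewrite !in_itv /= ltrBlDr lerBrDr.
rewrite /= !lebesgue_measure_itv /= !lte_fin ltrD2r.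
by case: ifP => // _; rewrite -!EFinB; congr EFin; lra.
Qed.

Definition shift3 (v : R * R * R) (p : R * R * R) : R * R * R :=
  (p.1.1 + v.1.1, p.1.2 + v.1.2, p.2 + v.2).

Lemma lebesgue2_sigma_finite : sigma_finite setT (@lebesgue2 R).
Proof.
pose I n : set (measurableTypeR R) := `[- n%:R, n%:R]%classic.
have mI n : measurable (I n) by exact: measurable_itv.
exists (fun n => I n `*` I n).
  apply/seteqP; split=> // -[a b] _.
  have [n nab] : exists n : nat, `|a| + `|b| <= n%:R.
    by exists (Num.bound (`|a| + `|b|)); rewrite ltW // archi_boundP ?addr_ge0.
  exists n => //; split; rewrite /I /= in_itv /= -ler_norml (le_trans _ nab) //.
    by rewrite lerDl.
  by rewrite lerDr.
move=> n; split; first exact: measurableX.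
rewrite /lebesgue2 product_measure1E // lte_mul_pinfty //.
  by rewrite /I /= lebesgue_measure_itv; case: ifP => // _; rewrite -EFinB.
by rewrite /I /= lebesgue_measure_itv; case: ifP => // _; rewrite -EFinB ltry.
Qed.

HB.instance Definition _ := Measure_isSigmaFinite.Build _ _ _ (@lebesgue2 R)
  lebesgue2_sigma_finite.

Lemma measure_preserving_shift3 v : measure_preserving (@lebesgue3 R)
  (shift3 v : measurableTypeR R * measurableTypeR R * measurableTypeR R -> _).
Proof.
have H2 : measure_preserving (@lebesgue2 R)
    (fun p : measurableTypeR R * measurableTypeR R => (p.1 + v.1.1, p.2 + v.1.2)) :=
  measure_preserving_prod (measure_preserving_shift v.1.1) (measure_preserving_shift v.1.2).
exact: (measure_preserving_prod H2 (measure_preserving_shift v.2)).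
Qed.

End MeasurePreserving.

(** * Measurability of continuous functions on the iterated product *)

Section JointMeasurability.
Context {R : realType}.

Lemma floor_approx_cvg (z : R) :
  (Num.floor (z * n.+1%:R))%:~R / n.+1%:R @[n --> \oo] --> z.
Proof.
have L : (z - n.+1%:R^-1) @[n --> \oo] --> z.
  by rewrite -[X in _ --> X]subr0; apply: cvgB; [exact: cvg_cst | exact: cvg_harmonic].
apply: (squeeze_cvgr _ L (cvg_cst z)); apply: nearW => n.
have /andP[fl fu] := real_floor_itv (num_real (z * n.+1%:R)).
rewrite ler_pdivrMr ?ltr0Sn // fl andbT lerBlDr -[X in _ + X]mul1r -mulrDl.
by rewrite ler_pdivlMr ?ltr0Sn // -(intrD _ _ 1) ltW.
Qed.

(* Discretise the continuous variable. *)
Lemma measurable_fun_caratheodory d (T : measurableType d) (F : T -> R -> R) :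
  (forall t, continuous (F t)) -> (forall z, measurable_fun setT (F ^~ z)) ->
  measurable_fun setT (fun p : T * measurableTypeR R => F p.1 p.2).
Proof.
move=> cF mF.
pose q (n : nat) (z : R) : R := (Num.floor (z * n.+1%:R))%:~R / n.+1%:R.
apply: (measurable_fun_cvg (h := fun n (p : T * measurableTypeR R) => F p.1 (q n p.2))).
  move=> n _ A mA; rewrite setTI.
  have -> : (fun p : T * measurableTypeR R => F p.1 (q n p.2)) @^-1` A =
    \bigcup_(k : int) ((F ^~ (k%:~R / n.+1%:R)) @^-1` A `*`
       `[k%:~R / n.+1%:R, (k + 1)%:~R / n.+1%:R[%classic).
    apply/seteqP; split=> [[t z] /= H|[t z] /= [k _ [/= H]]].
      exists (Num.floor (z * n.+1%:R)) => //; split => //=.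
      have := real_floor_itv (num_real (z * n.+1%:R)).
      by rewrite in_itv /= ler_pdivrMr ?ltr0Sn // ltr_pdivlMr ?ltr0Sn.
    rewrite in_itv /= ler_pdivrMr ?ltr0Sn // ltr_pdivlMr ?ltr0Sn // => /floor_def kE.
    by rewrite /q kE.
  apply: countable_bigcupT_measurable; first exact: countableP.
  move=> k; apply: measurableX; last exact: measurable_itv.
  by rewrite -[X in measurable X]setTI; exact: mF.
move=> [t z] _ /=.
have L : q ^~ z @ \oo --> (z : R) by exact: floor_approx_cvg.
exact: (continuous_cvg _ (cF t z) L).
Qed.

Lemma point3E (p : R * R) (z : R) :
  point3 (p, z) = point3 (p, 0) + z *: delta_mx 0 ord_max.
Proof.
apply/rowP => j; rewrite !mxE /=; case: j => [[|[|[|//]]] jP] /=.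
- by rewrite mulr0 addr0.
- by rewrite mulr0 addr0.
- by rewrite mulr1 add0r.
Qed.

Lemma point3E1 (a b : R) : point3 (a, b, 0) = point3 (a, 0, 0) + b *: delta_mx 0 1.
Proof.
apply/rowP => j; rewrite !mxE /=; case: j => [[|[|[|//]]] jP] /=.
- by rewrite mulr0 addr0.
- by rewrite mulr1 add0r.
- by rewrite mulr0 addr0.
Qed.

Lemma point3E0 (a : R) : point3 (a, 0, 0) = a *: delta_mx 0 0.
Proof.
apply/rowP => j; rewrite !mxE /=; case: j => [[|[|[|//]]] jP] /=.
- by rewrite mulr1.
- by rewrite mulr0.
- by rewrite mulr0.
Qed.

Lemma continuous_line (x v : 'rV[R]_3) : continuous (fun s : R => x + s *: v).
Proof. by move=> s; apply: cvgD; [exact: cvg_cst | apply: cvgZr_tmp; exact: cvg_id]. Qed.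

(** Measurability refers to the iterated product and continuity to row vectors. The two structures
    are never compared as a whole: one coordinate is added at a time, continuity being used only
    along lines. *)
Lemma measurable_continuous3 (g : 'rV[R]_3 -> R) : continuous g ->
  measurable_fun setT (fun p : measurableTypeR R * measurableTypeR R * measurableTypeR R =>
    g (point3 p)).
Proof.
move=> cg.
have cl x v : continuous (fun s : R => g (x + s *: v)).
  by move=> s; apply: continuous_comp; [exact: continuous_line | exact: cg].
have m2 z : measurable_fun setT (fun p : measurableTypeR R * measurableTypeR R =>
    g (point3 (p, z))).
  apply: (@measurable_fun_caratheodory _ (measurableTypeR R) (fun a b => g (point3 (a, b, z)))).
  - move=> a; rewrite (_ : (fun _ => _) =
      fun b => g ((point3 (a, 0, 0) + z *: delta_mx 0 ord_max) + b *: delta_mx 0 1)).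
      exact: cl.
    by apply/funext => b; rewrite point3E point3E1 addrAC.
  - move=> b; rewrite (_ : (fun _ => _) =
      fun a => g ((b *: delta_mx 0 1 + z *: delta_mx 0 ord_max) + a *: delta_mx 0 0)).
      apply: continuous_measurable_fun; exact: cl.
    by apply/funext => a; rewrite point3E point3E1 point3E0 [in RHS]addrC addrA.
apply: (@measurable_fun_caratheodory _ (measurableTypeR R * measurableTypeR R)%type
  (fun p z => g (point3 (p, z)))) => // p.
rewrite (_ : (fun _ => _) = fun z => g (point3 (p, 0) + z *: delta_mx 0 ord_max)).
  exact: cl.
by apply/funext => z; rewrite point3E.
Qed.

Lemma box_finite (rho : R) :
  let B := `[- rho, rho]%classic : set (measurableTypeR R) in
  measurable (B `*` B `*` B) /\ (lebesgue3 (B `*` B `*` B) < +oo)%E.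
Proof.
move=> B; have mB : measurable B by exact: measurable_itv.
have Bf : (lebesgue_measure B < +oo)%E.
  by rewrite /B /= lebesgue_measure_itv; case: ifP => // _; rewrite -EFinB ltry.
split; first by do 2 apply: measurableX => //.
have mBB : measurable (B `*` B) by exact: measurableX.
have E2 : lebesgue2 (B `*` B) = (lebesgue_measure B * lebesgue_measure B)%E.
  exact: product_measure1E.
have E3 : lebesgue3 (B `*` B `*` B) = (lebesgue2 (B `*` B) * lebesgue_measure B)%E.
  exact: product_measure1E.
have f1 : lebesgue_measure B \is a fin_num by rewrite ge0_fin_numE.
by rewrite E3 E2 -ge0_fin_numE ?mule_ge0 // !fin_numM.
Qed.

End JointMeasurability.

(** * Continuous functions with compact support *)

Section CompactSupport.
Context {R : realType}.
Variables (n : nat) (K : set 'rV[R]_n.+1).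
Hypothesis K_compact : compact K.

Lemma compact_norm_le : exists rho : R, forall x, K x -> `|x| <= rho.
Proof.
have [M [_ MP]] := compact_bounded K_compact.
by exists (M + 1) => x Kx; apply: (MP (M + 1)); rewrite // ltrDl.
Qed.

Lemma compact_support_bounded (g : 'rV[R]_n.+1 -> R) : continuous g ->
  (forall x, ~ K x -> g x = 0) -> exists2 M : R, 0 <= M & forall x, `|g x| <= M.
Proof.
move=> cg g0.
have : compact (g @` K) by apply: continuous_compact => //; exact: continuous_subspaceT.
move=> /compact_bounded[M [_ MP]]; exists `|M + 1| => // x.
have [Kx|/g0 ->] := pselect (K x); last by rewrite normr0.
by apply: le_trans (ler_norm _); apply: (MP (M + 1)); [rewrite ltrDl | exists x].
Qed.

(** The weights involve 1 / d and may be discontinuous on the boundary of Omega; off the closed set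
    K the product is locally 0. *)
Lemma continuous_mul_support (Omega : set 'rV[R]_n.+1) (g w : 'rV[R]_n.+1 -> R) :
  K `<=` Omega -> continuous g -> (forall x, ~ K x -> g x = 0) ->
  (forall x, Omega x -> {for x, continuous w}) -> continuous (fun x => g x * w x).
Proof.
move=> KO cg g0 cw x.
have [Kx|Kx] := pselect (K x).
  by apply: (@cvgM R _ _ (@nbhs_filter _ x) g w); [exact: cg | exact: cw (KO x Kx)].
have : nbhs x (~` K).
  have cK : closed K by apply: compact_closed K_compact; exact: norm_hausdorff.
  by apply: open_nbhs_nbhs; split => //; exact: closed_openC.
rewrite /continuous_at (g0 x Kx) mul0r => H.
have C := @cst_continuous 'rV[R]_n.+1 R 0 x.
have E : \forall y \near nbhs x, cst 0 y = g y * w y.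
  by apply: (@filterS _ _ (@nbhs_filter 'rV[R]_n.+1 x) _ _ _ H) => y /= /g0 ->; rewrite mul0r.
exact: cvg_trans (@near_eq_cvg _ _ _ (@nbhs_filter 'rV[R]_n.+1 x) _ _ E) C.
Qed.

End CompactSupport.

(** * Continuity of the second difference inside the domain *)

Section SecondDifferenceContinuity.
Context {R : realType}.
Variable Omega : set 'rV[R]_3.
Hypotheses (Omega_open : open Omega) (Omega_nT : ~` Omega !=set0).

Lemma sqrt_dist_continuous (v : 'rV[R]_3) :
  continuous (fun x : 'rV[R]_3 => Num.sqrt (dist_compl Omega (x + v))).
Proof.
move=> x; apply: (@continuous_comp 'rV[R]_3 R R
  (fun x => dist_compl Omega (x + v)) Num.sqrt); last exact: sqrt_continuous.
apply: (@continuous_comp 'rV[R]_3 'rV[R]_3 R (fun x => x + v) (dist_compl Omega)).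
  apply: (@continuousD R 'rV[R]_3 'rV[R]_3 id (cst v)); last exact: cst_continuous.
  by move=> A; exact: id.
exact: (dist_compl_continuous Omega_open Omega_nT).
Qed.

Lemma second_diff_continuous h i x : Omega x ->
  {for x, continuous (fun x => second_diff Omega x h i)}.
Proof.
move=> Ox.
have c0 : continuous (fun x : 'rV[R]_3 => Num.sqrt (dist_compl Omega x)).
  move=> z; apply: (@continuous_comp 'rV[R]_3 R R (dist_compl Omega) Num.sqrt).
    exact: (dist_compl_continuous Omega_open Omega_nT).
  exact: sqrt_continuous.
have k (r : R) := @cst_continuous 'rV[R]_3 R r x.
have F := @nbhs_filter 'rV[R]_3 x.
pose a z := Num.sqrt (dist_compl Omega (z + h *: delta_mx 0 i)).
pose b z := Num.sqrt (dist_compl Omega (z - h *: delta_mx 0 i)).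
pose c z := Num.sqrt (dist_compl Omega z).
have ab : {for x, continuous (fun z => a z + b z)}.
  by apply: (@cvgD _ _ _ _ F a b); exact: sqrt_dist_continuous.
have ci : {for x, continuous (fun z => (c z)^-1)}.
  apply: (@cvgV _ _ _ F c); last exact: c0.
  by rewrite gt_eqF // sqrtr_gt0; exact: dist_compl_gt0.
have abc : {for x, continuous (fun z => (a z + b z) * (c z)^-1)}.
  exact: (@cvgM _ _ _ F (fun z => a z + b z) (fun z => (c z)^-1) _ _ ab ci).
have d : {for x, continuous (fun z => 2 - (a z + b z) * (c z)^-1)}.
  exact: (@continuousB R R 'rV[R]_3 (cst 2) (fun z => (a z + b z) * (c z)^-1) x (k 2) abc).
exact: (@cvgM _ _ _ F (fun z => 2 - (a z + b z) * (c z)^-1) (cst (h ^+ 2)^-1) _ _ d (k _)).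
Qed.

End SecondDifferenceContinuity.

(** * Integration over the whole space *)

Section Integral3.
Context {R : realType}.
Implicit Types g k : 'rV[R]_3 -> R.

(** Translations do not preserve Omega, so the argument runs on the whole space, with integrands
    that vanish off a compact set. *)
Definition int3 g : \bar R := (\int[lebesgue3]_p (g (point3 p))%:E)%E.

Let T3 := (measurableTypeR R * measurableTypeR R * measurableTypeR R)%type.

Lemma measurable_int3 g : continuous g ->
  measurable_fun [set: T3] (fun p : T3 => (g (point3 p))%:E).
Proof. by move=> cg; apply/measurable_EFinP; exact: measurable_continuous3. Qed.

Lemma integral3E (Omega : set 'rV[R]_3) g :
  (forall x, ~ Omega x -> g x = 0) -> integral3 Omega g = int3 g.
Proof.
move=> g0; rewrite /integral3 integral_mkcond; apply: eq_integral => p _.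
by rewrite patchE; case: ifPn => //; rewrite notin_setE => /= /g0 ->.
Qed.

Lemma point3_coords (v : 'rV[R]_3) : point3 (v 0 0, v 0 1, v 0 ord_max) = v.
Proof.
apply/rowP => j; rewrite !mxE; case: j => [[|[|[|//]]] jP] /=;
  congr (v _ _); exact: val_inj.
Qed.

Lemma point3D (p q : R * R * R) : point3 (shift3 q p) = point3 p + point3 q.
Proof. by apply/rowP => j; rewrite !mxE; case: j => [[|[|[|//]]] jP]. Qed.

Lemma int3_shift g (v : 'rV[R]_3) : continuous g -> (forall x, 0 <= g x) ->
  int3 (fun x => g (x + v)) = int3 g.
Proof.
move=> cg g0; rewrite /int3.
have mp := measure_preserving_shift3 (v 0 0, v 0 1, v 0 ord_max).
have <- := ge0_integral_measure_preserving mp (measurable_int3 cg).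
  by apply: eq_integral => p _; rewrite point3D point3_coords.
by move=> p; rewrite lee_fin.
Qed.

Lemma int3_ge0 g : (forall x, 0 <= g x) -> (0 <= int3 g)%E.
Proof. by move=> g0; apply: integral_ge0 => p _; rewrite lee_fin. Qed.

Lemma int3D g k : continuous g -> continuous k -> (forall x, 0 <= g x) ->
  (forall x, 0 <= k x) -> int3 (fun x => g x + k x) = (int3 g + int3 k)%E.
Proof.
move=> cg ck g0 k0; rewrite /int3 -ge0_integralD //.
- by move=> p _; rewrite lee_fin.
- exact: measurable_int3.
- by move=> p _; rewrite lee_fin.
- exact: measurable_int3.
Qed.

Lemma int3Z (c : R) g : 0 <= c -> continuous g -> (forall x, 0 <= g x) ->
  int3 (fun x => c * g x) = (c%:E * int3 g)%E.
Proof.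
move=> c0 cg g0; rewrite /int3 -ge0_integralZl_EFin //.
- by move=> p _; rewrite lee_fin.
- exact: measurable_int3.
Qed.

Lemma le_int3 g k : continuous g -> continuous k -> (forall x, 0 <= g x) ->
  (forall x, g x <= k x) -> (int3 g <= int3 k)%E.
Proof.
move=> cg ck g0 gk; apply: ge0_le_integral => //.
- by move=> p _; rewrite lee_fin.
- exact: measurable_int3.
- exact: measurable_int3.
- by move=> p _; rewrite lee_fin.
Qed.

Definition box (rho : R) : set T3 :=
  let B := `[- rho, rho]%classic : set (measurableTypeR R) in B `*` B `*` B.

Lemma coord_le_norm (x : 'rV[R]_3) j : `|x 0 j| <= `|x|.
Proof.
rewrite [leRHS]/Num.Def.normr /= mx_normrE.
exact: (@le_bigmax _ _ _ 0 (fun ij : 'I_1 * 'I_3 => `|x ij.1 ij.2|) (0, j)).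
Qed.

Lemma box_norm rho (p : T3) : `|point3 p| <= rho -> box rho p.
Proof.
move=> le; have B j := le_trans (coord_le_norm (point3 p) j) le.
have := B 0; have := B 1; have := B ord_max; rewrite !mxE /= => b2 b1 b0.
by repeat split; rewrite /= in_itv /= -ler_norml.
Qed.

Lemma box_indic_integrable (rho M : R) :
  (@lebesgue3 R).-integrable setT (fun p => M%:E * (\1_(box rho) p)%:E)%E.
Proof.
have [mB Bf] := box_finite rho.
apply: integrableZl => //; apply/integrableP; split.
  exact/measurable_EFinP.
under eq_integral do rewrite gee0_abs ?lee_fin //.
by rewrite integral_indic // setIT.
Qed.

Lemma box_dominate g rho M : (forall x, rho < `|x| -> g x = 0) ->
  (forall x, `|g x| <= M) ->
  forall p : T3, (`|(g (point3 p))%:E| <= M%:E * (\1_(box rho) p)%:E)%E.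
Proof.
move=> g0 gM p; have [le|/g0 ->] := leP (`|point3 p|) rho.
  by rewrite indicE mem_set ?mule1 ?lee_fin //; exact: box_norm.
rewrite abse0 -EFinM lee_fin mulr_ge0 //.
by apply: le_trans (gM 0).
Qed.

Lemma int3_fin_num g rho M : continuous g -> (forall x, 0 <= g x) ->
  (forall x, rho < `|x| -> g x = 0) -> (forall x, `|g x| <= M) ->
  int3 g \is a fin_num.
Proof.
move=> cg g0 gs gM; apply: integrable_fin_num => //.
have M0 : 0 <= M by apply: le_trans (gM 0).
apply: le_integrable (box_indic_integrable rho M) => //.
  exact: measurable_int3.
move=> p _; rewrite [leRHS]gee0_abs; first exact: box_dominate.
by rewrite -EFinM lee_fin mulr_ge0.
Qed.

Lemma int3_dominated_cvg (g_ : nat -> 'rV[R]_3 -> R) g rho M :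
  (forall n, continuous (g_ n)) -> (forall x, g_ ^~ x @ \oo --> g x) ->
  (forall n x, rho < `|x| -> g_ n x = 0) -> (forall n x, `|g_ n x| <= M) ->
  int3 (g_ n) @[n --> \oo] --> int3 g.
Proof.
move=> cg gg gs gM.
apply: (@dominated_cvg _ _ _ (@lebesgue3 R) setT measurableT
  (fun n p => (g_ n (point3 p))%:E) (fun p => (g (point3 p))%:E)
  (fun p => M%:E * (\1_(box rho) p)%:E)%E).
- by move=> n; exact: measurable_int3.
- move=> p _; apply/fine_cvgP; split; last exact: gg.
  by apply: nearW.
- by move=> p _; rewrite -EFinM.
- exact: box_indic_integrable.
- by move=> n p _; apply: (box_dominate (gs n) (gM n)).
Qed.

End Integral3.

Section ContinuousFunctions.
Context {R : realType}.
Implicit Types g k : 'rV[R]_3 -> R.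

Lemma continuous_addf g k : continuous g -> continuous k ->
  continuous (fun x => g x + k x).
Proof.
by move=> cg ck x; apply: (@continuousD R R 'rV[R]_3 g k); [exact: cg | exact: ck].
Qed.

Lemma continuous_scalef (c : R) g : continuous g -> continuous (fun x => c * g x).
Proof.
move=> cg x; apply: (@cvgM _ _ _ (@nbhs_filter 'rV[R]_3 x) (cst c) g); last exact: cg.
exact: (@cst_continuous 'rV[R]_3 R c x).
Qed.

Lemma continuous_shiftf g (v : 'rV[R]_3) : continuous g ->
  continuous (fun x : 'rV[R]_3 => g (x + v)).
Proof.
move=> cg x; apply: (@continuous_comp 'rV[R]_3 'rV[R]_3 R (fun x : 'rV[R]_3 => x + v) g);
  last exact: cg.
apply: (@continuousD R 'rV[R]_3 'rV[R]_3 id (cst v)); last exact: cst_continuous.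
by move=> A; exact: id.
Qed.

End ContinuousFunctions.

(** * The discrete ground state inequality *)

Section GroundState.
Context {R : realType}.
Variables (Omega K : set 'rV[R]_3) (f : 'rV[R]_3 -> R).
Hypotheses (Omega_open : open Omega) (boundary_nonempty : boundary Omega !=set0).
Hypotheses (K_compact : compact K) (KO : K `<=` Omega).
Hypotheses (f_cont : continuous f) (f0 : forall x, ~ K x -> f x = 0).

Let Omega_nT : ~` Omega !=set0 := compl_nonempty Omega_open boundary_nonempty.

Definition weighted (w : 'rV[R]_3 -> R) (x : 'rV[R]_3) : R := f x ^+ 2 * w x.

Lemma sqr_continuous : continuous (fun x => f x ^+ 2).
Proof.
move=> x; apply: (@continuous_comp 'rV[R]_3 R R f (fun r => r ^+ 2)); first exact: f_cont.
exact: exprn_continuous.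
Qed.

Lemma weighted0 w x : ~ K x -> weighted w x = 0.
Proof. by move=> /f0 fx; rewrite /weighted fx expr0n /= mul0r. Qed.

Lemma weighted_continuous (w : 'rV[R]_3 -> R) : (forall x, Omega x -> {for x, continuous w}) ->
  continuous (weighted w).
Proof.
apply: (continuous_mul_support K_compact KO sqr_continuous) => x /f0 ->.
by rewrite expr0n.
Qed.

Lemma weighted_ge0 (w : 'rV[R]_3 -> R) : (forall x, Omega x -> 0 <= w x) ->
  forall x, 0 <= weighted w x.
Proof.
move=> w0 x; have [Kx|Kx] := pselect (K x); last by rewrite weighted0.
by rewrite mulr_ge0 ?sqr_ge0 // w0 //; exact: KO.
Qed.

Lemma int3_weighted_fin (w : 'rV[R]_3 -> R) : (forall x, Omega x -> {for x, continuous w}) ->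
  (forall x, Omega x -> 0 <= w x) -> int3 (weighted w) \is a fin_num.
Proof.
move=> cw w0; have cW := weighted_continuous cw.
have [rho rhoP] := compact_norm_le K_compact.
have [M _ MP] := compact_support_bounded K_compact cW (weighted0 w).
apply: (@int3_fin_num _ _ rho M) => //; first exact: weighted_ge0.
move=> x xr; apply: weighted0 => /rhoP; apply/negP.
by rewrite -ltNge.
Qed.

Definition inv_sqr_dist (x : 'rV[R]_3) : R := (dist_compl Omega x ^+ 2)^-1.

Lemma inv_sqr_dist_continuous x : Omega x -> {for x, continuous inv_sqr_dist}.
Proof.
move=> Ox.
have F := @nbhs_filter 'rV[R]_3 x.
apply: (@cvgV _ _ _ F (fun x => dist_compl Omega x ^+ 2)).
  by rewrite expf_neq0 // gt_eqF // dist_compl_gt0.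
apply: (@continuous_comp 'rV[R]_3 R R (dist_compl Omega) (fun r => r ^+ 2)).
  exact: (dist_compl_continuous Omega_open Omega_nT).
exact: exprn_continuous.
Qed.

Lemma const_continuous_at (c : R) (x : 'rV[R]_3) : {for x, continuous (fun=> c : R)}.
Proof. exact: (@cst_continuous 'rV[R]_3 R c x). Qed.

Lemma ratio_continuous v x : Omega x ->
  {for x, continuous (fun x : 'rV[R]_3 =>
    Num.sqrt (dist_compl Omega (x + v)) / Num.sqrt (dist_compl Omega x))}.
Proof.
move=> Ox; have F := @nbhs_filter 'rV[R]_3 x.
pose c z := Num.sqrt (dist_compl Omega z).
have c0 : {for x, continuous c}.
  apply: (@continuous_comp 'rV[R]_3 R R (dist_compl Omega) Num.sqrt).
    exact: (dist_compl_continuous Omega_open Omega_nT).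
  exact: sqrt_continuous.
have ci : {for x, continuous (fun z => (c z)^-1)}.
  apply: (@cvgV _ _ _ F c); last exact: c0.
  by rewrite gt_eqF // sqrtr_gt0; exact: dist_compl_gt0.
exact: (@cvgM _ _ _ F (fun z => c (z + v)) (fun z => (c z)^-1) _ _
  (@sqrt_dist_continuous _ _ Omega_open Omega_nT v x) ci).
Qed.

(* Expanding (f(y) u(x) - f(x) u(y))^2 / (u(x) u(y)) >= 0. *)
Lemma ground_state_ineq (fx fy ux uy : R) : 0 <= ux -> 0 <= uy ->
  (ux = 0 -> fx = 0) -> (uy = 0 -> fy = 0) ->
  fx ^+ 2 + fy ^+ 2 <= (fy - fx) ^+ 2 + (fx ^+ 2 * (uy / ux) + fy ^+ 2 * (ux / uy)).
Proof.
move=> ux0 uy0 hx hy.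
have [ux00|ux00] := eqVneq ux 0.
  by rewrite hx // ux00 mul0r mulr0 expr0n /= mul0r !addr0 subr0 add0r.
have [uy00|uy00] := eqVneq uy 0.
  by rewrite hy // uy00 mul0r mulr0 expr0n /= mul0r !addr0 sub0r sqrrN.
have ux1 : 0 < ux by rewrite lt_def ux00.
have uy1 : 0 < uy by rewrite lt_def uy00.
rewrite -subr_ge0; set L := _ - _.
have -> : L = (fy * ux - fx * uy) ^+ 2 / (ux * uy).
  by rewrite /L; field; rewrite ux00 uy00.
by rewrite divr_ge0 ?sqr_ge0 // mulr_ge0.
Qed.

(** This settles the degenerate cases of [ground_state_ineq]: f vanishes wherever u does, and the
    quotients by 0 are 0. *)
Lemma sqrt_dist_eq0 x : Num.sqrt (dist_compl Omega x) = 0 -> f x = 0.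
Proof.
move=> /eqP; rewrite sqrtr_eq0 => d0; apply: f0 => Kx.
by have := dist_compl_gt0 Omega_open Omega_nT (KO Kx); rewrite ltNge d0.
Qed.

Definition diff_quotient (h : R) (i : 'I_3) (x : 'rV[R]_3) : R :=
  (f (x + h *: delta_mx 0 i) - f x) / h.

Lemma diff_quotient_continuous h i : continuous (fun x => diff_quotient h i x ^+ 2).
Proof.
move=> x; have F := @nbhs_filter 'rV[R]_3 x.
apply: (@continuous_comp 'rV[R]_3 R R (diff_quotient h i) (fun r => r ^+ 2)); last first.
  exact: exprn_continuous.
apply: (@cvgM _ _ _ F (fun x => f (x + h *: delta_mx 0 i) - f x) (cst h^-1));
  last exact: const_continuous_at.
apply: (@continuousB R R 'rV[R]_3 (fun x => f (x + h *: delta_mx 0 i)) f); last exact: f_cont.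
exact: continuous_shiftf.
Qed.

(** The summand 1 / (2 d^2) is the lower bound of [second_diff_ge] with its sign reversed: the
    weight becomes nonnegative, and all integrals are those of nonnegative functions. *)
Definition shifted_second_diff h i x : R :=
  second_diff Omega x h i + 2^-1 * inv_sqr_dist x.

Lemma inv_sqr_dist_ge0 x : 0 <= inv_sqr_dist x.
Proof. by rewrite invr_ge0 sqr_ge0. Qed.

Lemma shifted_second_diff_continuous h i x : Omega x ->
  {for x, continuous (shifted_second_diff h i)}.
Proof.
move=> Ox.
have F := @nbhs_filter 'rV[R]_3 x.
apply: (@continuousD R R 'rV[R]_3 (fun x => second_diff Omega x h i)
  (fun x => 2^-1 * inv_sqr_dist x)).
  exact: second_diff_continuous.
apply: (@cvgM _ _ _ F (cst 2^-1) inv_sqr_dist); first exact: const_continuous_at.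
exact: inv_sqr_dist_continuous.
Qed.

Lemma shifted_second_diff_ge0 h i x : h != 0 -> Omega x ->
  0 <= shifted_second_diff h i x.
Proof.
move=> h0 Ox; rewrite /shifted_second_diff /inv_sqr_dist -invfM -lerBlDr sub0r.
exact: second_diff_ge.
Qed.

(** Here [iu] stands for 1 / u(x). The negative terms are moved across, so that both sides integrate
    without subtraction of extended reals. *)
Lemma second_diff_split (fx h u1 u2 iu r : R) : h != 0 ->
  h ^+ 2 * (fx ^+ 2 * ((2 - (u1 + u2) * iu) / h ^+ 2 + 2^-1 * r))
    + (fx ^+ 2 * (u1 * iu) + fx ^+ 2 * (u2 * iu))
  = 2 * fx ^+ 2 + (h ^+ 2 / 2) * (fx ^+ 2 * r).
Proof. by move=> h0; field. Qed.

(** The arithmetic of [ground_state_step], where [H] is h^2, [A] and [B] are the integrals with the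
    ratios u(x + v) / u(x) and u(x - v) / u(x), and [I] is that of f^2. Finiteness allows these to
    be cancelled; [G], the integral of the squared difference quotient, may be infinite. *)
Lemma cancel_ratios (H A B I Q P G : \bar R) :
  H \is a fin_num -> (0 < H)%E -> A \is a fin_num -> B \is a fin_num -> I \is a fin_num ->
  Q \is a fin_num -> P \is a fin_num -> (0 <= G)%E ->
  (H * P + (A + B) = 2%:E * I + (H * (2^-1)%:E) * Q)%E ->
  (I + I <= H * G + (A + B))%E -> (P <= G + (2^-1)%:E * Q)%E.
Proof.
case: H => // H _; rewrite lte_fin => H0.
case: A => // A _; case: B => // B _; case: I => // I _; case: Q => // Q _.
case: P => // P _; case: G => // [G|] _; last by rewrite addye // leey.
move=> [E]; rewrite -!EFinM -!EFinD !lee_fin => L.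
rewrite -(ler_pM2l H0) mulrDr mulrA; lra.
Qed.

(** The pointwise inequality pairs x with x + v, while the second difference at x also involves x -
    v. Translating the term in x - v by v produces f(x + v)^2 u(x) / u(x + v), the second ratio of
    the pointwise inequality. *)
Lemma ground_state_step h i : h != 0 ->
  (int3 (weighted (shifted_second_diff h i))
   <= int3 (fun x => diff_quotient h i x ^+ 2)%R + (2^-1)%:E * int3 (weighted inv_sqr_dist))%E.
Proof.
move=> h0; pose v : 'rV[R]_3 := h *: delta_mx 0 i.
pose u x := Num.sqrt (dist_compl Omega x).
have u0 x : 0 <= u x by exact: sqrtr_ge0.
pose a := weighted (fun x => u (x + v) / u x).
pose b := weighted (fun x => u (x - v) / u x).
pose P := weighted (shifted_second_diff h i).
pose q := weighted inv_sqr_dist.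
pose G x := diff_quotient h i x ^+ 2.
pose f2 x := f x ^+ 2.
have ca : continuous a by apply: weighted_continuous; exact: ratio_continuous.
have cb : continuous b by apply: weighted_continuous; exact: ratio_continuous.
have cP : continuous P.
  by apply: weighted_continuous => x; exact: shifted_second_diff_continuous.
have cq : continuous q by apply: weighted_continuous; exact: inv_sqr_dist_continuous.
have cG : continuous G by exact: diff_quotient_continuous.
have cf2 : continuous f2 by exact: sqr_continuous.
have a0 x : 0 <= a x by apply: weighted_ge0 => y _; rewrite divr_ge0.
have b0 x : 0 <= b x by apply: weighted_ge0 => y _; rewrite divr_ge0.
have P0 x : 0 <= P x by apply: weighted_ge0 => y; exact: shifted_second_diff_ge0.
have q0 x : 0 <= q x by apply: weighted_ge0 => y _; exact: inv_sqr_dist_ge0.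
have G0 x : 0 <= G x by exact: sqr_ge0.
have f20 x : 0 <= f2 x by exact: sqr_ge0.
have H0 : 0 < h ^+ 2 by rewrite exprn_even_gt0.
have fina : int3 a \is a fin_num.
  by apply: int3_weighted_fin => x; [exact: ratio_continuous | rewrite divr_ge0].
have finb : int3 b \is a fin_num.
  by apply: int3_weighted_fin => x; [exact: ratio_continuous | rewrite divr_ge0].
have finP : int3 P \is a fin_num.
  apply: int3_weighted_fin => x; first exact: shifted_second_diff_continuous.
  exact: shifted_second_diff_ge0.
have finq : int3 q \is a fin_num.
  apply: int3_weighted_fin => x; first exact: inv_sqr_dist_continuous.
  by move=> _; exact: inv_sqr_dist_ge0.
have finf : int3 f2 \is a fin_num.
  have -> : f2 = weighted (fun=> 1) by apply/funext => x; rewrite /weighted mulr1.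
  by apply: int3_weighted_fin => x _; [exact: const_continuous_at | exact: ler01].
apply: (@cancel_ratios (h ^+ 2)%:E (int3 a) (int3 b) (int3 f2)) => //.
- exact: int3_ge0.
- rewrite -EFinM.
  have c1 : continuous (fun x => h ^+ 2 * P x) by exact: continuous_scalef.
  have c2 : continuous (fun x => a x + b x) by exact: continuous_addf.
  have c3 : continuous (fun x => 2 * f2 x) by exact: continuous_scalef.
  have c4 : continuous (fun x => h ^+ 2 / 2 * q x) by exact: continuous_scalef.
  have h20 : 0 <= h ^+ 2 / 2 by rewrite divr_ge0 // ltW.
  rewrite -(int3Z (ltW H0) cP P0) -(int3D ca cb a0 b0).
  rewrite -(int3Z (ler0n _ 2) cf2 f20) -(int3Z h20 cq q0).
  rewrite -(int3D c1 c2) => [|x|x]; last by rewrite addr_ge0.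
    rewrite -(int3D c3 c4) => [|x|x]; last by rewrite mulr_ge0.
      by congr int3; apply/funext => x; exact: second_diff_split.
    by rewrite mulr_ge0.
  by rewrite mulr_ge0 // ltW.
- rewrite -(int3Z (ltW H0) cG G0) -{2}(int3_shift v cf2 f20) -(int3_shift v cb b0).
  have c1 : continuous (fun x : 'rV[R]_3 => f2 (x + v)) by exact: continuous_shiftf.
  have c2 : continuous (fun x : 'rV[R]_3 => b (x + v)) by exact: continuous_shiftf.
  have c3 : continuous (fun x => h ^+ 2 * G x) by exact: continuous_scalef.
  have c4 : continuous (fun x => a x + b (x + v)) by exact: continuous_addf.
  rewrite -(int3D cf2 c1) // -(int3D ca c2) // -(int3D c3 c4) => [|x|x].
  + apply: le_int3 => [||x|x]; [exact: continuous_addf | exact: continuous_addf| |].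
      by rewrite addr_ge0.
    have -> : h ^+ 2 * G x = (f (x + v) - f x) ^+ 2.
      by rewrite /G /diff_quotient -/v expr_div_n mulrC divfK // expf_neq0.
    rewrite /f2 /a /b /weighted addrK.
    by apply: ground_state_ineq => //; exact: sqrt_dist_eq0.
  + by rewrite mulr_ge0 // ltW.
  + by rewrite addr_ge0.
Qed.

End GroundState.

(** * The step tends to zero *)

Section Limit.
Context {R : realType}.
Variables (Omega K : set 'rV[R]_3) (f : 'rV[R]_3 -> R).
Hypotheses (Omega_open : open Omega) (boundary_nonempty : boundary Omega !=set0).
Hypothesis Omega_minimal : minimal_boundary Omega.
Hypotheses (K_compact : compact K) (KO : K `<=` Omega).
Hypotheses (f_cont : continuous f) (f0 : forall x, ~ K x -> f x = 0).
Hypothesis f_derivable : forall i x, derivable f x (delta_mx 0 i).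
Hypothesis df_cont : forall i, continuous (partial i f).

Definition step (n : nat) : R := n.+1%:R^-1.

Lemma step_neq0 n : step n != 0.
Proof. by rewrite invr_neq0. Qed.

Lemma near_step (P : R -> Prop) : (\forall h \near (0 : R)^', P h) ->
  \forall n \near \oo, P (step n).
Proof.
rewrite near_withinE => H.
have [N _ HN] := cvg_harmonic H.
by exists N => // n /HN; apply; exact: (step_neq0 n).
Qed.

Lemma partial_off_support i x : ~ K x -> partial i f x = 0.
Proof.
move=> Kx.
have cK : closed K by apply: compact_closed K_compact; exact: norm_hausdorff.
have Kn : nbhs x (~` K) by apply: open_nbhs_nbhs; split => //; exact: closed_openC.
have E : \forall y \near x, f y = cst 0 y.
  by apply: (@filterS _ _ (@nbhs_filter 'rV[R]_3 x) _ _ _ Kn) => y /= /f0.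
by rewrite /partial (near_eq_derive _ E) derive_cst.
Qed.

Lemma diff_quotient_cvg i x :
  (fun n => diff_quotient f (step n) i x ^+ 2) @ \oo --> partial i f x ^+ 2.
Proof.
have H : (fun h => h^-1 *: ((f \o shift x) (h *: delta_mx 0 i) - f x)) @ (0 : R)^'
   --> partial i f x := @f_derivable i x.
have L : (fun n => diff_quotient f (step n) i x) @ \oo --> partial i f x.
  apply/cvgrPdist_le => e e0.
  move/cvgrPdist_le : H => /(_ e e0) /near_step; apply: filterS => n.
  suff -> : diff_quotient f (step n) i x = (step n)^-1 *:
    ((f \o shift x) (step n *: delta_mx 0 i) - f x) by [].
  by rewrite /diff_quotient mulrC /= [step n *: _ + x]addrC.
by rewrite expr2; under eq_fun do rewrite expr2; exact: cvgM.
Qed.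

Lemma diff_quotient_bounded i : exists2 C : R, 0 <= C &
  forall n x, `|diff_quotient f (step n) i x ^+ 2| <= C.
Proof.
have [C C0 CP] := compact_support_bounded K_compact (@df_cont i)
  (fun x => @partial_off_support i x).
exists (C ^+ 2); first exact: sqr_ge0.
move=> n x; rewrite normrX ler_pXn2r ?nnegrE // /diff_quotient.
have [r _ ->] := taylor1_line x (step n) (fun y => @f_derivable i y).
by rewrite addrAC subrr add0r mulrC mulrA mulVf ?step_neq0 // mul1r CP.
Qed.

Lemma diff_quotient_support rho : (forall x, K x -> `|x| <= rho) ->
  forall n i x, rho + 1 < `|x| -> diff_quotient f (step n) i x ^+ 2 = 0.
Proof.
move=> rhoP n i x xr.
have out y : rho < `|y| -> f y = 0.
  by move=> yr; apply: f0 => /rhoP; apply/negP; rewrite -ltNge.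
rewrite /diff_quotient !out ?subrr ?mul0r ?expr0n //.
  by apply: le_lt_trans xr; rewrite lerDl.
(* Steps never exceed 1, which is why the support grows by at most 1. *)
have e1 : `|step n *: (delta_mx 0 i : 'rV[R]_3)| <= 1.
  apply: le_trans (norm_le_enorm _) _.
  rewrite enormZ ger0_norm ?invr_ge0 //.
  rewrite /enorm (bigD1 i) //= mxE !eqxx big1 => [|j /negPf ji]; last first.
    by rewrite mxE ji andbF expr0n.
  by rewrite addr0 expr1n sqrtr1 mulr1 invf_le1 ?ltr0Sn // ler1n.
have := ler_normB (x + step n *: delta_mx 0 i) (step n *: delta_mx 0 i).
rewrite addrK; lra.
Qed.

(** The term with 3/2 comes from the three shifts by 1 / (2 d^2). The same amount stands on the
    other side of [limit_inequality], and [cancel_half3] removes both. *)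
Definition limit_weight (x : 'rV[R]_3) : R :=
  4^-1 * inv_sqr_dist Omega x + kappa0 Omega ^+ 2 + (3 / 2) * inv_sqr_dist Omega x.

Definition total_weight n (x : 'rV[R]_3) : R :=
  \sum_i shifted_second_diff Omega (step n) i x.

(** The second differences are controlled only through a lower bound of their liminf at each point.
    The minimum with the limit is dominated by that limit, the liminf bound makes it converge there,
    and it does not exceed the integrand that the ground state inequality estimates. *)
Definition truncated n : 'rV[R]_3 -> R :=
  weighted f (total_weight n) \min weighted f limit_weight.

Lemma limit_weight_ge0 x : 0 <= limit_weight x.
Proof.
have := sqr_ge0 (kappa0 Omega); have := inv_sqr_dist_ge0 Omega x.
rewrite /limit_weight; lra.
Qed.

Lemma truncated_cvg x : truncated ^~ x @ \oo --> weighted f limit_weight x.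
Proof.
have [Kx|Kx] := pselect (K x); last first.
  rewrite (weighted0 f0) // (_ : (fun n => _) = cst 0); first exact: cvg_cst.
  by apply/funext => n; rewrite /truncated /= !(weighted0 f0) // minxx.
have Ox := KO Kx.
apply/cvgrPdist_le => e e0.
(* This choice gives f(x)^2 eta <= e; adding 1 covers the case f(x) = 0. *)
have eta0 : 0 < e / (f x ^+ 2 + 1) by rewrite divr_gt0 // ltr_wpDl ?sqr_ge0.
have := near_step (second_diff_liminf Omega_open boundary_nonempty Omega_minimal Ox eta0).
apply: filterS => n le.
rewrite /truncated /=; set W := weighted f limit_weight x.
have WT : W - e <= weighted f (total_weight n) x.
  rewrite /W /weighted /limit_weight /total_weight.
  have -> : \sum_i shifted_second_diff Omega (step n) i x
    = \sum_i second_diff Omega x (step n) i + 3 / 2 * inv_sqr_dist Omega x.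
    by rewrite big_split /= sumr_const card_ord; congr (_ + _); rewrite -mulr_natr; lra.
  rewrite invfM -/(inv_sqr_dist Omega x) in le.
  have fe : f x ^+ 2 * (e / (f x ^+ 2 + 1)) <= e.
    rewrite mulrCA -[leRHS]mulr1 ler_pM2l // ler_pdivrMr ?ltr_wpDl ?sqr_ge0 //.
    by rewrite mul1r lerDl.
  have := ler_wpM2l (sqr_ge0 (f x)) le; lra.
by rewrite ler_norml; case: (leP (weighted f (total_weight n) x) W) => ?; apply/andP; split; lra.
Qed.

Lemma limit_weight_continuous x : Omega x -> {for x, continuous limit_weight}.
Proof.
move=> Ox; have F := @nbhs_filter 'rV[R]_3 x.
have k (c : R) := @const_continuous_at R c x.
have d := inv_sqr_dist_continuous Omega_open boundary_nonempty Ox.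
have s (c : R) : {for x, continuous (fun x => c * inv_sqr_dist Omega x)}.
  exact: (@cvgM _ _ _ F (fun=> c) (inv_sqr_dist Omega) _ _ (k c) d).
apply: (@continuousD R R 'rV[R]_3 (fun x => 4^-1 * inv_sqr_dist Omega x + kappa0 Omega ^+ 2)
  (fun x => (3 / 2) * inv_sqr_dist Omega x)); last exact: s.
by apply: (@continuousD R R 'rV[R]_3 (fun x => 4^-1 * inv_sqr_dist Omega x)
  (fun=> kappa0 Omega ^+ 2)); [exact: s | exact: k].
Qed.

Lemma total_weight_continuous n x : Omega x -> {for x, continuous (total_weight n)}.
Proof.
move=> Ox; have F := @nbhs_filter 'rV[R]_3 x.
have c i := @shifted_second_diff_continuous R Omega Omega_open boundary_nonempty (step n) i x Ox.
have -> : total_weight n = (fun x => shifted_second_diff Omega (step n) 0 x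
    + shifted_second_diff Omega (step n) 1 x + shifted_second_diff Omega (step n) ord_max x).
  by apply/funext => y; exact: sum_ord3.
apply: (@continuousD R R 'rV[R]_3 (fun x => shifted_second_diff Omega (step n) 0 x
    + shifted_second_diff Omega (step n) 1 x) (shifted_second_diff Omega (step n) ord_max));
  last exact: c.
by apply: (@continuousD R R 'rV[R]_3 (shifted_second_diff Omega (step n) 0)
    (shifted_second_diff Omega (step n) 1)); exact: c.
Qed.

Lemma truncated_continuous n : continuous (truncated n).
Proof.
move=> x; apply: (@continuous_min R 'rV[R]_3).
  by apply: (weighted_continuous K_compact KO f_cont f0 (@total_weight_continuous n)).
by apply: (weighted_continuous K_compact KO f_cont f0 limit_weight_continuous).
Qed.

Lemma total_weight_ge0 n x : Omega x -> 0 <= total_weight n x.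
Proof.
move=> Ox; apply: sumr_ge0 => i _.
exact: (shifted_second_diff_ge0 Omega_open boundary_nonempty i (step_neq0 n) Ox).
Qed.

Lemma truncated_ge0 n x : 0 <= truncated n x.
Proof.
rewrite /truncated /= le_min; apply/andP; split.
  by apply: (weighted_ge0 KO f0) => y; exact: total_weight_ge0.
by apply: (weighted_ge0 KO f0) => y _; exact: limit_weight_ge0.
Qed.

Lemma int3_total_weight n :
  int3 (weighted f (total_weight n)) =
  (\sum_(i < 3) int3 (weighted f (shifted_second_diff Omega (step n) i)))%E.
Proof.
have c i : continuous (weighted f (shifted_second_diff Omega (step n) i)).
  apply: (weighted_continuous K_compact KO f_cont f0) => x.
  exact: (shifted_second_diff_continuous Omega_open boundary_nonempty).
have p i x : 0 <= weighted f (shifted_second_diff Omega (step n) i) x.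
  apply: (weighted_ge0 KO f0) => y.
  exact: (shifted_second_diff_ge0 Omega_open boundary_nonempty i (step_neq0 n)).
have -> : weighted f (total_weight n) = (fun x =>
    (weighted f (shifted_second_diff Omega (step n) 0) x
     + weighted f (shifted_second_diff Omega (step n) 1) x)
     + weighted f (shifted_second_diff Omega (step n) ord_max) x).
  have distr (a b d e : R) : a * (b + d + e) = a * b + a * d + a * e by ring.
  by apply/funext => x; rewrite /weighted /total_weight sum_ord3; exact: distr.
have cD := continuous_addf (c 0) (c 1).
rewrite (int3D cD (c ord_max)) => [|x|x]; [|by rewrite addr_ge0|exact: p].
rewrite (int3D (c 0) (c 1) (p 0) (p 1)).
rewrite !big_ord_recr big_ord0 /= add0e.
by congr (int3 (weighted _ (shifted_second_diff _ _ _)) + int3 (weighted _ (shifted_second_diff _ _ _))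
  + int3 (weighted _ (shifted_second_diff _ _ _)))%E; exact: val_inj.
Qed.

Let Iq : \bar R := int3 (weighted f (inv_sqr_dist Omega)).

Lemma sqr_partial_continuous i : continuous (fun x => partial i f x ^+ 2).
Proof.
move=> x; apply: (@continuous_comp 'rV[R]_3 R R (partial i f) (fun r => r ^+ 2)).
  exact: df_cont.
exact: exprn_continuous.
Qed.

Lemma int3_sqr_partial_fin i : int3 (fun x => partial i f x ^+ 2) \is a fin_num.
Proof.
have [rho rhoP] := compact_norm_le K_compact.
have s0 x : ~ K x -> partial i f x ^+ 2 = 0.
  by move=> /partial_off_support ->; rewrite expr0n.
have [M _ MP] := compact_support_bounded K_compact (@sqr_partial_continuous i) s0.
apply: (@int3_fin_num _ _ rho M) => //; first exact: sqr_partial_continuous.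
  by move=> x; exact: sqr_ge0.
by move=> x xr; apply: s0 => /rhoP; apply/negP; rewrite -ltNge.
Qed.

Lemma int3_truncated_le n : (int3 (truncated n) <=
  \sum_(i < 3) (int3 (fun x => diff_quotient f (step n) i x ^+ 2)%R + (2^-1)%:E * Iq))%E.
Proof.
apply: (@le_trans _ _ (int3 (weighted f (total_weight n)))).
  apply: le_int3; [exact: truncated_continuous | | exact: truncated_ge0 |].
    apply: (weighted_continuous K_compact KO f_cont f0).
    exact: (@total_weight_continuous n).
  by move=> x; rewrite /truncated /= ge_min lexx.
rewrite int3_total_weight; apply: lee_sum => i _.
exact: (ground_state_step Omega_open boundary_nonempty K_compact KO f_cont f0 i (step_neq0 n)).
Qed.

Lemma int3_truncated_cvg :
  int3 (truncated n) @[n --> \oo] --> int3 (weighted f limit_weight).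
Proof.
have [rho rhoP] := compact_norm_le K_compact.
have cT := weighted_continuous K_compact KO f_cont f0 limit_weight_continuous.
have [M _ MP] := compact_support_bounded K_compact cT (weighted0 f0 limit_weight).
apply: (@int3_dominated_cvg _ _ _ rho M).
- exact: truncated_continuous.
- exact: truncated_cvg.
- move=> n x xr; have Kx : ~ K x by move=> /rhoP; apply/negP; rewrite -ltNge.
  by rewrite /truncated /= !(weighted0 f0 _ Kx) minxx.
- move=> n x; rewrite ger0_norm ?truncated_ge0 //.
  apply: le_trans (MP x); apply: le_trans (ler_norm _).
  by rewrite /truncated /= ge_min lexx orbT.
Qed.

Lemma int3_diff_quotient_cvg i :
  int3 (fun x => diff_quotient f (step n) i x ^+ 2) @[n --> \oo]
    --> int3 (fun x => partial i f x ^+ 2).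
Proof.
have [rho rhoP] := compact_norm_le K_compact.
have [C _ CP] := diff_quotient_bounded i.
apply: (@int3_dominated_cvg _ _ _ (rho + 1) C).
- by move=> n; exact: diff_quotient_continuous.
- exact: diff_quotient_cvg.
- by move=> n x; exact: diff_quotient_support.
- exact: CP.
Qed.

Lemma int3_inv_sqr_dist_fin : Iq \is a fin_num.
Proof.
apply: (int3_weighted_fin K_compact KO f_cont f0) => x.
  exact: inv_sqr_dist_continuous.
by move=> _; exact: inv_sqr_dist_ge0.
Qed.

Lemma limit_inequality : (int3 (weighted f limit_weight) <=
  \sum_(i < 3) (int3 (fun x => partial i f x ^+ 2)%R + (2^-1)%:E * Iq))%E.
Proof.
have Iqf := int3_inv_sqr_dist_fin.
have c i : ((int3 (fun x => diff_quotient f (step n) i x ^+ 2)%R + (2^-1)%:E * Iq)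
    @[n --> \oo] --> int3 (fun x => partial i f x ^+ 2)%R + (2^-1)%:E * Iq)%E.
  apply: cvgeD; [|exact: int3_diff_quotient_cvg|exact: cvg_cst].
  by rewrite fin_num_adde_defr ?int3_sqr_partial_fin.
have fin i : (int3 (fun x => partial i f x ^+ 2)%R + (2^-1)%:E * Iq)%E \is a fin_num.
  by rewrite fin_numD int3_sqr_partial_fin fin_numM.
have L : ((\sum_(i < 3) (int3 (fun x => diff_quotient f (step n) i x ^+ 2)%R
      + (2^-1)%:E * Iq)) @[n --> \oo] -->
    \sum_(i < 3) (int3 (fun x => partial i f x ^+ 2)%R + (2^-1)%:E * Iq))%E.
  apply: cvg_nnesum => [i _|i _]; last exact: c.
  apply: nearW => n; rewrite adde_ge0 ?mule_ge0 ?int3_ge0 // => x.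
    exact: sqr_ge0.
  by apply: (weighted_ge0 KO f0) => y _; exact: inv_sqr_dist_ge0.
rewrite -(cvg_lim _ int3_truncated_cvg) // -(cvg_lim _ L) //.
apply: lee_lim; [by apply: cvgP int3_truncated_cvg | by apply: cvgP L |].
by apply: nearW => n; exact: int3_truncated_le.
Qed.

Lemma cancel_half3 (k : R) (Q I D0 D1 D2 : \bar R) :
  Q \is a fin_num -> I \is a fin_num -> D0 \is a fin_num -> D1 \is a fin_num ->
  D2 \is a fin_num ->
  ((4^-1)%:E * Q + k%:E * I + (3 / 2)%:E * Q <=
   D0 + (2^-1)%:E * Q + (D1 + (2^-1)%:E * Q) + (D2 + (2^-1)%:E * Q))%E ->
  ((4^-1)%:E * Q + k%:E * I <= D0 + D1 + D2)%E.
Proof.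
case: Q => // Q _; case: I => // I _; case: D0 => // D0 _; case: D1 => // D1 _.
case: D2 => // D2 _; rewrite -!EFinM -!EFinD !lee_fin => H.
move: (k * I) H => kI H; lra.
Qed.

Lemma hardy_minimal : ((4^-1)%:E * Iq + (kappa0 Omega ^+ 2)%:E * int3 (fun x => f x ^+ 2)%R
  <= int3 (fun x => enorm (gradient f x) ^+ 2)%R)%E.
Proof.
have Iqf : Iq \is a fin_num by exact: int3_inv_sqr_dist_fin.
pose q := weighted f (inv_sqr_dist Omega).
have cq : continuous q.
  apply: (weighted_continuous K_compact KO f_cont f0).
  exact: inv_sqr_dist_continuous.
have q0 x : 0 <= q x by apply: (weighted_ge0 KO f0) => y _; exact: inv_sqr_dist_ge0.
pose f2 x := f x ^+ 2.
have cf2 : continuous f2 by exact: sqr_continuous.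
have f20 x : 0 <= f2 x by exact: sqr_ge0.
have finf : int3 f2 \is a fin_num.
  have -> : f2 = weighted f (fun=> 1) by apply/funext => x; rewrite /weighted mulr1.
  apply: (int3_weighted_fin K_compact KO f_cont f0) => x _; last exact: ler01.
  exact: const_continuous_at.
have lhs : (int3 (weighted f limit_weight) =
    (4^-1)%:E * Iq + (kappa0 Omega ^+ 2)%:E * int3 f2 + (3 / 2)%:E * Iq)%E.
  have q4 : 0 <= 4^-1 :> R by rewrite invr_ge0.
  have t2 : 0 <= 3 / 2 :> R by rewrite divr_ge0.
  have k2 := sqr_ge0 (kappa0 Omega).
  have c1 : continuous (fun x => 4^-1 * q x) by exact: continuous_scalef.
  have c2 : continuous (fun x => kappa0 Omega ^+ 2 * f2 x) by exact: continuous_scalef.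
  have c3 : continuous (fun x => 3 / 2 * q x) by exact: continuous_scalef.
  have c12 := continuous_addf c1 c2.
  rewrite -(int3Z q4 cq q0) -(int3Z k2 cf2 f20) -(int3Z t2 cq q0).
  rewrite -(int3D c1 c2) => [|x|x]; [|by rewrite mulr_ge0|by rewrite mulr_ge0].
  rewrite -(int3D c12 c3) => [|x|x]; [|by rewrite addr_ge0 // mulr_ge0|by rewrite mulr_ge0].
  congr int3; apply/funext => x; rewrite /weighted /limit_weight /q /f2 /weighted.
  by move: (inv_sqr_dist Omega x) (kappa0 Omega) (f x) => u v w; ring.
have rhs : int3 (fun x => enorm (gradient f x) ^+ 2) =
    (int3 (fun x => partial 0 f x ^+ 2)%R + int3 (fun x => partial 1 f x ^+ 2)%R
     + int3 (fun x => partial ord_max f x ^+ 2)%R)%E.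
  have p0 i x : 0 <= partial i f x ^+ 2 by exact: sqr_ge0.
  have cp := sqr_partial_continuous.
  have c01 := continuous_addf (@cp 0) (@cp 1).
  rewrite -(int3D (@cp 0) (@cp 1) (p0 0) (p0 1)) -(int3D c01 (@cp ord_max)) => [|x|x].
  - by congr int3; apply/funext => x; rewrite sqr_enorm sum_ord3 !mxE.
  - by rewrite addr_ge0.
  - exact: p0.
have := limit_inequality; rewrite lhs rhs.
rewrite !big_ord_recr big_ord0 /= add0e.
set i0 := widen_ord _ _; set i1 := widen_ord _ _; set i2 := ord_max.
have -> : i0 = 0 by exact: val_inj.
have -> : i1 = 1 by exact: val_inj.
exact: (cancel_half3 Iqf finf (int3_sqr_partial_fin 0) (int3_sqr_partial_fin 1)
  (int3_sqr_partial_fin ord_max)).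
Qed.

End Limit.

Theorem corollary1p5 (R : realType) (Omega : set 'rV[R]_3)
    (Omega_open : open Omega) (Omega_connected : connected Omega)
    (boundary_nonempty : boundary Omega !=set0)
    (Omega_C2 : C2_boundary Omega)
    (Omega_minimal : minimal_boundary Omega)
    (f : 'rV[R]_3 -> R) (f_test : test_function Omega f) :
  ((4^-1)%:E *
     integral3 Omega (fun x => `|f x| ^+ 2 / dist_compl Omega x ^+ 2)%R +
   (kappa0 Omega ^+ 2)%:E * integral3 Omega (fun x => `|f x| ^+ 2)%R
   <= integral3 Omega (fun x => enorm (gradient f x) ^+ 2)%R)%E.
Proof.
have [sf cK KO] := f_test.
set K := closure [set x | f x != 0] in cK KO.
have f0 x : ~ K x -> f x = 0.
  by move=> Kx; apply: contrapT => /eqP fx; apply: Kx; exact: subset_closure.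
have f_cont : continuous f by case: (sf 0) => _ /(_ [::]); exact.
have f_der i x : derivable f x (delta_mx 0 i) by case: (sf 1) => /(_ [::]) H _; exact: H.
have df_cont i : continuous (partial i f) by case: (sf 1) => _ /(_ [:: i]); exact.
have out x : ~ Omega x -> f x = 0 by move=> Ox; apply: f0 => /KO.
have := hardy_minimal Omega_open boundary_nonempty Omega_minimal cK KO f_cont f0 f_der df_cont.
rewrite !integral3E.
- congr (_ * int3 _ + _ * int3 _ <= _)%E; apply/funext => x.
    by rewrite /weighted /inv_sqr_dist real_normK ?num_real.
  by rewrite real_normK ?num_real.
- move=> x Ox; rewrite sqr_enorm big1 // => i _; rewrite mxE.
  rewrite (partial_off_support cK f0) ?expr0n //.
  by move=> /KO.
- by move=> x /out ->; rewrite normr0 expr0n.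
- by move=> x /out ->; rewrite normr0 expr0n /= mul0r.
Qed.
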